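(* Let $\mathbb{F}$ be a field, let $V$ be an infinite-dimensional vector space over $\mathbb{F}$, and let $u\in\mathrm{End}(V)$. Then $u$ is the sum of three square-zero endomorphisms of $V$ if and only if none of the following situations occurs: (i) there exist $\lambda\in\mathbb{F}$ and a finite-rank endomorphism $w\in\mathrm{End}(V)$ such that $\operatorname{tr}w\notin\{0,\lambda\}$ and $u=\lambda\,\mathrm{id}_V+w$; (ii) the characteristic of $\mathbb{F}$ differs from $2$ and $u$ has a non-zero dominant eigenvalue.
   Context: A scalar $\lambda$ is a dominant eigenvalue of $u\in\mathrm{End}(V)$ if $\operatorname{rk}(u-\lambda\,\mathrm{id}_V)<\dim V$. An endomorphism $a$ is square-zero if $a^2=0$. The trace of a finite-rank endomorphism is the usual trace (e.g. the trace of its restriction to any finite-dimensional subspace $W$ with $\operatorname{im}w\subset W$). *)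

(* Defs.v *)
From HB Require Import structures.
From mathcomp Require Import all_boot all_order all_algebra.
Set Implicit Arguments. Unset Strict Implicit. Unset Printing Implicit Defensive.
Import Order.TTheory GRing.Theory Num.Theory.
Local Open Scope ring_scope.

Section Defs.
Variables (F : fieldType) (V : lmodType F).

Definition lin_indep (B : V -> Prop) : Prop :=
  forall (s : seq V) (c : V -> F), uniq s -> (forall v, v \in s -> B v) ->
    \sum_(v <- s) c v *: v = 0 -> forall v, v \in s -> c v = 0.

Definition in_span (B : V -> Prop) (x : V) : Prop :=
  exists (s : seq V) (c : V -> F),
    (forall v, v \in s -> B v) /\ x = \sum_(v <- s) c v *: v.

Definition is_basis_of (W B : V -> Prop) : Prop :=
  [/\ forall v, B v -> W v, lin_indep B & forall x, W x -> in_span B x].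

Definition dim_le (W1 W2 : V -> Prop) : Prop :=
  exists (B1 B2 : V -> Prop), [/\ is_basis_of W1 B1, is_basis_of W2 B2 &
    exists f : V -> V, (forall x, B1 x -> B2 (f x)) /\
      (forall x y, B1 x -> B1 y -> f x = f y -> x = y)].

Definition rank_lt_dim (f : V -> V) : Prop :=
  ~ dim_le (fun _ => True) (fun y => exists x, y = f x).

Definition dominant_eigenvalue (u : V -> V) (lam : F) : Prop :=
  rank_lt_dim (fun x => u x - lam *: x).

Definition infinite_dim : Prop :=
  forall n : nat, exists s : seq V,
    [/\ size s = n, uniq s & lin_indep (fun v => v \in s)].

Definition finite_rank (f : V -> V) : Prop :=
  exists s : seq V, forall x, in_span (fun v => v \in s) (f x).

(* t is the trace of the finite-rank endomorphism f: the trace of the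
   restriction of f to a finite-dimensional subspace W (with basis e)
   containing the image of f. *)
Definition is_trace (f : V -> V) (t : F) : Prop :=
  exists (n : nat) (e : 'I_n -> V) (a : 'I_n -> 'I_n -> F),
    [/\ forall c : 'I_n -> F, \sum_i c i *: e i = 0 -> forall i, c i = 0,
        forall x, exists c : 'I_n -> F, f x = \sum_i c i *: e i,
        forall i, f (e i) = \sum_j a i j *: e j
      & t = \sum_i a i i].

Definition square_zero (a : V -> V) : Prop := forall x, a (a x) = 0.

End Defs.

(* Main.v *)
Require Import Defs.
From HB Require Import structures.
From mathcomp Require Import all_boot all_order all_algebra.
From mathcomp Require Import boolp classical_sets functions cardinality.
From mathcomp Require Import ring.
Set Implicit Arguments. Unset Strict Implicit. Unset Printing Implicit Defensive.
Import Order.TTheory GRing.Theory Num.Theory.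
Local Open Scope ring_scope.

(**
Sufficiency. If [u - c] is odd for a grading of [V] modulo 2, it is the sum of
two square-zero maps, so one looks for a grading and a square-zero [c] with
the same diagonal blocks as [u]. When [u] maps a part of [x_a] bijectively
onto a part of [y_a] and its block on the span of the [y_a] is a commutator [J
R - R J], the blocks [- R J] and [J R] (after a shear) do the job. By Zorn's
lemma take a maximal [X] such that [X] and [u X] are jointly independent; then
[u - lam] maps [V] into the span of [X], [u X], [u^2 X] for some [lam]. If [X]
is infinite, [J] is a locally nilpotent shift with infinitely many chains of
infinite length, which makes every block a commutator. If [X] is finite, [u -
lam] has finite rank, Krylov chains reduce the block to a triangular matrix,
and this is a commutator with a nilpotent shift exactly when its trace
vanishes.

Necessity. If [u = lam + w = a + b + c], then [a b + b a] equals [lam^2 - 2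
lam c] modulo the ideal generated by [w]. If [2 lam <> 0], then [a], [b], [c]
commute modulo this ideal, so that [lam] is nilpotent modulo it; if [2 lam =
0] and [w] has finite rank, then [im w] lies in a finite-dimensional subspace
stable under [a], [b], [c], and traces can be compared there.
*)

(** * Linear identities by reflection *)

(** The scalar [lam] is harmless when [V] has a basis no larger than [X]: chains then fill all of
    [V]. Otherwise the rank of [u - lam] is below the dimension, [lam] is dominant, and excluding
    (ii) leaves only [lam + lam = 0]. In that case [V] splits into a [u]-stable span of chains and
    an infinite part inside the kernel of [u - lam], where the scalar [lam] is treated directly. In
    finite rank the number to annihilate is the trace of [u] on the ends of the chains. It agrees
    with [tr w] up to a multiple of [lam], hence is [0] or [lam], and moving one eigenvector into
    the chains changes it by [lam]. This is why exactly two traces are allowed. The square-zero map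
    [c] is obtained as a composite [rho] after [pi] through the span of the chain ends, with [pi]
    after [rho] equal to zero; this factorisation is what makes commutators appear as the blocks. *)

Section LmodReflection.
Variables (F : fieldType) (V : lmodType F).

Inductive mexp :=
  MZero | MVar of nat | MAdd of mexp & mexp | MOpp of mexp | MScale of F & mexp.

Fixpoint meval (env : seq V) e : V :=
  match e with
  | MZero => 0
  | MVar i => nth 0 env i
  | MAdd e1 e2 => meval env e1 + meval env e2
  | MOpp e1 => - meval env e1
  | MScale a e1 => a *: meval env e1
  end.

(** [Nat.eqb] is used because [lmod] has to reduce the coefficients by [cbn] before it calls
    [ring]. *)
Fixpoint mcoef e (i : nat) : F :=
  match e with
  | MZero => 0
  | MVar j => if Nat.eqb i j then 1 else 0
  | MAdd e1 e2 => mcoef e1 i + mcoef e2 i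
  | MOpp e1 => - mcoef e1 i
  | MScale a e1 => a * mcoef e1 i
  end.

(** A conjunction instead of a quantified statement, so that [lmod] meets one [ring] goal per
    atom. *)
Fixpoint mcoef_eq n e1 e2 : Prop :=
  if n is n'.+1 then mcoef e1 n' = mcoef e2 n' /\ mcoef_eq n' e1 e2 else True.

Lemma mevalE env e : meval env e = \sum_(i < size env) mcoef e i *: nth 0 env i.
Proof.
elim: e => [|j|e1 IH1 e2 IH2|e IH|a e IH] /=.
- by rewrite big1 // => i _; rewrite scale0r.
- have EqbE i k : Nat.eqb i k = (i == k) by elim: i k => [|i IH] [|k] //=; rewrite IH eqSS.
  have [jn|nj] := ltnP j (size env); last first.
    rewrite nth_default // big1 // => i _; rewrite EqbE.
    by have := ltn_ord i; case: eqP => [->|]; rewrite ?scale0r // ltnNge nj.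
  rewrite (bigD1 (Ordinal jn)) //= EqbE eqxx scale1r big1 ?addr0 // => i ij.
  rewrite EqbE; case: eqP => [e|]; last by rewrite scale0r.
  by case/eqP: ij; apply: val_inj.
- by rewrite IH1 IH2 -big_split; apply: eq_bigr => i _; rewrite scalerDl.
- by rewrite IH -sumrN; apply: eq_bigr => i _; rewrite scaleNr.
- by rewrite IH scaler_sumr; apply: eq_bigr => i _; rewrite scalerA.
Qed.

Lemma mcoef_eqP env e1 e2 : mcoef_eq (size env) e1 e2 -> meval env e1 = meval env e2.
Proof.
move=> h; rewrite !mevalE; apply: eq_bigr => i _; congr (_ *: _).
move: (ltn_ord i) h; move: (nat_of_ord i) => k.
elim: (size env) => //= n IH lt [h1 h2]; move: lt.
by rewrite ltnS leq_eqVlt => /predU1P[->//|/IH]; apply.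
Qed.

End LmodReflection.

(** Atoms are compared by type-checking a proof of equality, hence up to conversion. *)
Ltac lmod_mem x l :=
  match l with
  | nil => constr:(false)
  | ?y :: _ => let _ := constr:(erefl : x = y) in constr:(true)
  | _ :: ?l' => lmod_mem x l'
  end.
Ltac lmod_index x l :=
  match l with
  | ?y :: _ => let _ := constr:(erefl : x = y) in constr:(0%N)
  | _ :: ?l' => let n := lmod_index x l' in constr:(S n)
  end.
Ltac lmod_atoms t l :=
  lazymatch t with
  | @Algebra.zero _ => l
  | @Algebra.add _ ?a ?b => let l1 := lmod_atoms a l in lmod_atoms b l1
  | @Algebra.opp _ ?a => lmod_atoms a l
  | @GRing.scale _ _ _ ?a => lmod_atoms a l
  | _ => let m := lmod_mem t l in
         lazymatch m with true => l | false => constr:(t :: l) end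
  end.
Ltac lmod_reify F t l :=
  lazymatch t with
  | @Algebra.zero _ => constr:(@MZero F)
  | @Algebra.add _ ?a ?b => let e1 := lmod_reify F a l in let e2 := lmod_reify F b l in
                          constr:(@MAdd F e1 e2)
  | @Algebra.opp _ ?a => let e1 := lmod_reify F a l in constr:(@MOpp F e1)
  | @GRing.scale _ _ ?c ?a => let e1 := lmod_reify F a l in constr:(@MScale F c e1)
  | _ => let n := lmod_index t l in constr:(@MVar F n)
  end.
(* Decides linear identities in a module, up to ring identities between the
   scalar coefficients. *)
Ltac lmod V :=
  lazymatch goal with
  | |- @eq _ ?a ?b =>
    let F := lazymatch type of V with GRing.Lmodule.type (GRing_Field__to__GRing_PzRing ?F) => F end in
    let l0 := lmod_atoms a (@nil (GRing.Lmodule.sort V)) in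
    let l := lmod_atoms b l0 in
    let e1 := lmod_reify F a l in
    let e2 := lmod_reify F b l in
    refine (@mcoef_eqP _ V l e1 e2 _); cbn [mcoef mcoef_eq size Nat.eqb];
    repeat (split; [ring|]); exact I
  end.

(** * Cardinality *)

Definition le_set (T U : Type) (A : T -> Prop) (B : U -> Prop) : Prop :=
  exists f : T -> U, (forall x, A x -> B (f x)) /\
    (forall x y, A x -> A y -> f x = f y -> x = y).

Definition infset (T : Type) (A : T -> Prop) : Prop :=
  le_set (fun _ : nat => True) A.

Lemma le_set_trans (T U W : Type) (A : T -> Prop) (B : U -> Prop) (C : W -> Prop) :
  le_set A B -> le_set B C -> le_set A C.
Proof.
move=> [f [fB fi]] [g [gC gi]]; exists (g \o f); split=> [x /fB/gC//|x y Ax Ay].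
by move=> /(gi _ _ (fB _ Ax) (fB _ Ay)); apply: fi.
Qed.

Lemma le_set_image (T U : Type) (A : T -> Prop) (B : U -> Prop) (h : U -> T) (t0 : U) :
  (forall x, A x -> exists2 t, B t & h t = x) -> le_set A B.
Proof.
move=> hA; have /choice[f fP] : forall x, exists t, A x -> B t /\ h t = x.
  by move=> x; have [/hA[t Bt <-]|nAx] := pselect (A x); [exists t|exists t0].
exists f; split=> [x /fP[]//|x y Ax Ay fxy].
by have [_ <-] := fP _ Ax; have [_ <-] := fP _ Ay; rewrite fxy.
Qed.

Lemma le_set_sub (T : Type) (A B : T -> Prop) :
  (forall x, A x -> B x) -> le_set A B.
Proof. by move=> AB; exists id. Qed.

Lemma finite_or_infset (T : eqType) (A : T -> Prop) :
  (exists s : seq T, forall x, A x -> x \in s) \/ infset A.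
Proof.
have [|Ninf] := pselect (exists s : seq T, forall x, A x -> x \in s); first by left.
right; have /choice[f fP] : forall s : seq T, exists x, A x /\ x \notin s.
  move=> s; apply: contrapT => nx; apply: Ninf; exists s => x Ax.
  by apply: contrapT => /negP xs; apply: nx; exists x.
pose S := fix S n := if n is n'.+1 then f (S n') :: S n' else [::].
exists (f \o S); split=> [n _|m n _ _ /=]; first by case: (fP (S n)).
have memS i j : (i < j)%N -> f (S i) \in S j.
  elim: j => // j IH; rewrite ltnS leq_eqVlt => /predU1P[->|/IH] /=.
    by rewrite inE eqxx.
  by rewrite inE orbC => ->.
case: (ltngtP m n) => // /memS; last move=> + e; move=> + ; move=> h.
  by move=> e; case: (fP (S n)) => _; rewrite -e h.
by case: (fP (S m)) => _; rewrite e h.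
Qed.

Lemma finite_not_infset (T : eqType) (A : T -> Prop) (s : seq T) :
  (forall x, A x -> x \in s) -> ~ infset A.
Proof.
move=> As [f [fA fi]].
have : (size (map f (iota 0 (size s).+1)) <= size s)%N.
  apply: uniq_leq_size.
    by rewrite map_inj_uniq ?iota_uniq// => x y; apply: fi.
  by move=> _ /mapP[n _ ->]; apply/As/fA.
by rewrite size_map size_iota ltnn.
Qed.

(** Zorn's lemma cuts [A], up to a finite remainder, into disjoint injective sequences. So [A]
    injects into [F * nat], and the factor [nat] absorbs a second one through [pickle]. *)
Lemma infset_prod_nat (T : eqType) (A : T -> Prop) :
  infset A -> le_set (fun p : T * nat => A p.1) A.
Proof.
move=> infA.
pose P (F : set (nat -> T)) := (forall f, F f -> forall n, A (f n)) /\
  (forall f g n m, F f -> F g -> f n = g m -> f = g /\ n = m).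
have [F [[FA Finj] Fmax]] : exists F, P F /\ forall B, (F `<` B)%classic -> ~ P B.
  apply: Zorn_bigcup => C CP Ctot; split.
    by move=> f [F CF Ff]; case: (CP _ CF) => + _; apply.
  move=> f g n m [F CF Ff] [G CG Gg] e.
  have [FG|GF] := Ctot _ _ CF CG.
    by case: (CP _ CG) => _; apply; rewrite //; apply: FG.
  by case: (CP _ CF) => _; apply; rewrite //; apply: GF.
pose R x := A x /\ forall f n, F f -> f n <> x.
(* An infinite remainder would contain one more sequence [g], against maximality. *)
have [[s sR]|[g [gR gi]]] := finite_or_infset R; last first.
  exfalso; pose F' : set (nat -> T) := fun f => F f \/ f = g.
  have gF : ~ F g by move=> Fg; case: (gR 0%N I) => _ /(_ g 0%N Fg).
  apply: (Fmax F').
    split; last by move=> /(_ g (or_intror erefl)).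
    by move=> f Ff; left.
  split=> [f [/FA//|->] n|f h n m]; first by case: (gR n I).
  move=> [Ff|->] [Fh|->]; first exact: Finj.
  - by move=> e; case: (gR m I) => _ /(_ f n Ff).
  - by move=> /esym e; case: (gR n I) => _ /(_ h m Fh).
  - by move=> /(gi _ _ I I).
have [f0 Ff0] : exists f, F f.
  apply: contrapT => nF; apply: (@finite_not_infset _ A s) => // x Ax.
  by apply: sR; split=> // f n Ff; case: nF; exists f.
(* every sequence but [f0] is kept; [f0] absorbs the finite remainder *)
have covA x : A x -> exists p : (nat -> T) * nat, F p.1 /\
    ((p.1 <> f0 /\ p.1 p.2 = x) \/ (p.1 = f0 /\
      ((size s <= p.2)%N /\ f0 (p.2 - size s)%N = x \/
      (p.2 < size s)%N /\ nth x s p.2 = x))).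
  move=> Ax; have [[f [n [Ff fx]]]|nx] := pselect (exists f n, F f /\ f n = x).
    have [ff0|ff0] := pselect (f = f0); last by exists (f, n); split=> //; left.
    exists (f0, n + size s)%N; split=> //; right; split=> //=; left.
    by rewrite leq_addl addnK -ff0.
  have xs : x \in s by apply: sR; split=> // f n Ff fx; apply: nx; exists f, n.
  exists (f0, index x s); split=> //; right; split=> //=; right.
  by rewrite index_mem nth_index.
have /choice[e eP] : forall x, exists p : (nat -> T) * nat, A x -> F p.1 /\
    ((p.1 <> f0 /\ p.1 p.2 = x) \/ (p.1 = f0 /\
      ((size s <= p.2)%N /\ f0 (p.2 - size s)%N = x \/
      (p.2 < size s)%N /\ nth x s p.2 = x))).
  move=> x; have [/covA[p pP]|] := pselect (A x); first by exists p.
  by exists (f0, 0%N).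
have einj x y : A x -> A y -> e x = e y -> x = y.
  move=> Ax Ay exy; have [Fx hx] := eP x Ax; have [Fy hy] := eP y Ay.
  rewrite exy in hx; case: hx hy => [[h1 h2]|[h1 hx]] [[k1 k2]|[k1 hy]]; [exact: (etrans (esym h2) k2)|by []|by []|].
  case: hx hy => [[h2 hx]|[h2 hx]] [[k2 hy]|[k2 hy]].
  - exact: (etrans (esym hx) hy).
  - by move: k2; rewrite ltnNge h2.
  - by move: h2; rewrite ltnNge k2.
  - by apply: (etrans (esym hx)); apply: etrans hy; apply: set_nth_default.
exists (fun p => (e p.1).1 (pickle ((e p.1).2, p.2))); split=> [p Ap|p q Ap Aq].
  by apply: FA; case: (eP _ Ap).
case: (eP _ Ap) => Fp _; case: (eP _ Aq) => Fq _.
move=> /(Finj _ _ _ _ Fp Fq)[e1 /(pcan_inj pickleK)[e2 e3]].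
case: p q Ap Aq Fp Fq e1 e2 e3 => [x n] [y m] /= Ax Ay _ _ e1 e2 ->.
by rewrite (einj x y) //; move: e1 e2; case: (e x) => ? ?; case: (e y) => ? ? /= -> ->.
Qed.

Lemma le_set_antisym (T U : Type) (A : T -> Prop) (B : U -> Prop) (u0 : U) :
  le_set A B -> le_set B A -> exists f : T -> U, [/\ forall x, A x -> B (f x),
    forall x y, A x -> A y -> f x = f y -> x = y
    & forall y, B y -> exists2 x, A x & f x = y].
Proof.
elim/Ppointed: U => U in B u0 *; first by case: (no u0).
have card_le (T' U' : Type) (C : T' -> Prop) (D : U' -> Prop) :
    le_set C D -> card_le C D.
  move=> [f [fD fi]]; suff /injfunPex[g] : exists2 f, set_fun C D f & set_inj C f.
    exact: inj_card_le g.
  by exists f => // x y; rewrite !inE; apply: fi.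
move=> /card_le AB /card_le BA; have := Cantor_Bernstein AB BA.
move=> /card_set_bijP[f [fB fi fs]]; exists f; split=> //.
by move=> x y Ax Ay; apply: fi; rewrite inE.
Qed.

(** A finite list taken from the union of a chain of sets already lies in one of them. Both bases
    and doubly independent sets are produced this way. *)
Lemma zorn_finite_character (T : eqType) (Q : seq T -> Prop) : Q [::] ->
  exists X : T -> Prop, (forall s, (forall x, x \in s -> X x) -> Q s) /\
    forall X' : T -> Prop, (forall x, X x -> X' x) ->
      (forall s, (forall x, x \in s -> X' x) -> Q s) -> forall x, X' x -> X x.
Proof.
move=> Q0; pose P (X : set T) := forall s, (forall x, x \in s -> X x) -> Q s.
have [X [PX Xmax]] : exists X, P X /\ forall B, (X `<` B)%classic -> ~ P B.
  apply: Zorn_bigcup => C CP Ctot s sC.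
  have [->//|s0] := eqVneq s [::].
  suff [Y CY sY] : exists2 Y, C Y & forall x, x \in s -> Y x by apply: (CP Y).
  elim: s s0 sC => // x s IH _ sC.
  have [Y CY Yx] : exists2 Y, C Y & Y x by apply: sC; rewrite mem_head.
  have [->|s0] := eqVneq s [::].
    by exists Y => // y; rewrite inE => /eqP->.
  have [|Z CZ sZ] := IH s0; first by move=> y ys; apply: sC; rewrite inE ys orbT.
  have [YZ|ZY] := Ctot _ _ CY CZ.
    by exists Z => // y; rewrite inE => /predU1P[->|/sZ//]; apply: YZ.
  by exists Y => // y; rewrite inE => /predU1P[->|/sZ/ZY].
exists X; split=> // X' XX' PX' x X'x; apply: contrapT => nXx.
by apply: (Xmax X') => //; split=> // X'X; apply/nXx/X'X.
Qed.


Lemma le_set_or (T U : eqType) (A B : T -> Prop) (X : U -> Prop) :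
  infset X -> le_set A X -> le_set B X -> le_set (fun v => A v \/ B v) X.
Proof.
move=> infX [f [fX fi]] [g [gX gi]]; apply: le_set_trans (infset_prod_nat infX).
exists (fun v => if `[< A v >] then (f v, 0%N) else (g v, 1%N)).
split=> [v|v w]; first by case: asboolP => [/fX//|nA [//|/gX]].
case: asboolP => [Av|nA] + +; case: asboolP => [Aw|nA'] //.
  by move=> _ _ [/(fi _ _ Av Aw)].
by move=> [//|Bv] [//|Bw] [/(gi _ _ Bv Bw)].
Qed.

(** * Spans and bases *)

Definition mklin (F : fieldType) (U W : lmodType F) (f : U -> W) (fl : linear f) :
    {linear U -> W} := HB.pack f (GRing.isLinear.Build F U W *:%R f fl).

Section Span.
Variables (F : fieldType) (V : lmodType F).
Implicit Types (B C : V -> Prop) (x y : V) (s t : seq V).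

(** Brings combinations with different supports to a common list, where their coefficients can be
    added or compared. *)
Lemma sum_uniq_sub (U : lmodType F) s t (c : V -> F) (g : V -> U) :
  uniq s -> uniq t -> {subset s <= t} ->
  \sum_(v <- s) c v *: g v = \sum_(v <- t) (if v \in s then c v else 0) *: g v.
Proof.
move=> us ut st; rewrite [RHS](bigID (mem s)) /= [X in _ + X]big1 ?addr0; last first.
  by move=> v /negbTE->; rewrite scale0r.
rewrite [RHS](eq_bigr (fun v => c v *: g v)); last by move=> v ->.
rewrite -[RHS]big_filter; apply: perm_big; apply: uniq_perm => //; first exact: filter_uniq.
by move=> v; rewrite mem_filter andb_idr //; apply: st.
Qed.

Lemma span_uniq B x : in_span B x -> exists s (c : V -> F),
  [/\ uniq s, forall v, v \in s -> B v & x = \sum_(v <- s) c v *: v].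
Proof.
(* A vector listed several times contributes its coefficient with multiplicity. *)
move=> [s [c [sB ->]]]; exists (undup s), (fun v => c v *+ count_mem v s).
split=> [|v|]; [exact: undup_uniq|by rewrite mem_undup => /sB|].
rewrite -big_undup_iterop_count; apply: eq_bigr => v _.
by rewrite Monoid.iteropE iter_addr_0 scalerMnl.
Qed.

Lemma span_gen B x : B x -> in_span B x.
Proof.
move=> Bx; exists [:: x], (fun _ => 1); split; last by rewrite big_seq1 scale1r.
by move=> v; rewrite inE => /eqP->.
Qed.

Lemma span0 B : in_span B 0.
Proof. by exists [::], (fun _ => 0); rewrite big_nil. Qed.

Lemma spanP B a x y : in_span B x -> in_span B y -> in_span B (a *: x + y).
Proof.
move=> /span_uniq[s [c [us sB ->]]] /span_uniq[t [d [ut tB ->]]].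
pose r := undup (s ++ t).
have ur : uniq r by exact: undup_uniq.
exists r, (fun v => a * (if v \in s then c v else 0) + (if v \in t then d v else 0)).
split=> [v|]; first by rewrite mem_undup mem_cat => /orP[/sB|/tB].
rewrite (@sum_uniq_sub _ s r c id) //; last by move=> v vs; rewrite mem_undup mem_cat vs.
rewrite (@sum_uniq_sub _ t r d id) //; last by move=> v vs; rewrite mem_undup mem_cat vs orbT.
rewrite scaler_sumr -big_split; apply: eq_bigr => v _ /=.
by rewrite scalerDl scalerA.
Qed.

Lemma spanD B x y : in_span B x -> in_span B y -> in_span B (x + y).
Proof. by move=> Bx By; rewrite -[x]scale1r; apply: spanP. Qed.

Lemma spanZ B a x : in_span B x -> in_span B (a *: x).
Proof. by move=> Bx; rewrite -[a *: x]addr0; apply: spanP Bx (span0 _). Qed.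

Lemma spanN B x : in_span B x -> in_span B (- x).
Proof. by move=> Bx; rewrite -scaleN1r; apply: spanZ. Qed.

Lemma spanB B x y : in_span B x -> in_span B y -> in_span B (x - y).
Proof. by move=> Bx By; apply: spanD => //; apply: spanN. Qed.

Lemma span_sum (I : Type) (r : seq I) (P : pred I) B (f : I -> V) :
  (forall i, P i -> in_span B (f i)) -> in_span B (\sum_(i <- r | P i) f i).
Proof.
by move=> Bf; apply: (big_ind (in_span B)) => //; [apply: span0|apply: spanD].
Qed.

Lemma span_ind B (P : V -> Prop) : P 0 -> (forall a x y, P x -> P y -> P (a *: x + y)) ->
  (forall x, B x -> P x) -> forall x, in_span B x -> P x.
Proof.
move=> P0 PD BP _ [s [c [sB ->]]]; elim: s sB => [|v s IH] sB; first by rewrite big_nil.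
rewrite big_cons; apply: PD; first by apply/BP/sB; rewrite inE eqxx.
by apply: IH => w ws; apply: sB; rewrite inE ws orbT.
Qed.

Lemma span_lin (f : {linear V -> V}) B C : (forall v, B v -> in_span C (f v)) ->
  forall x, in_span B x -> in_span C (f x).
Proof.
move=> BC; apply: span_ind => [|a x y fx fy|//]; first by rewrite linear0; apply: span0.
by rewrite linearP; apply: spanP.
Qed.

Lemma span_sub B C : (forall v, B v -> in_span C v) -> forall x, in_span B x -> in_span C x.
Proof. exact: (@span_lin (@idfun V)). Qed.

Lemma span_mono B C : (forall v, B v -> C v) -> forall x, in_span B x -> in_span C x.
Proof. by move=> BC; apply: span_sub => v /BC /span_gen. Qed.

Lemma span_eq (U : lmodType F) (f g : {linear V -> U}) B : (forall v, B v -> f v = g v) ->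
  forall x, in_span B x -> f x = g x.
Proof.
move=> fg; apply: span_ind => [|a x y fx fy|//]; first by rewrite !linear0.
by rewrite !linearP fx fy.
Qed.

Lemma lin_indep_sub B C : (forall v, B v -> C v) -> lin_indep C -> lin_indep B.
Proof. by move=> BC iC s c us sB; apply: iC => // v /sB /BC. Qed.

Lemma span_or B x y : in_span (fun v => B v \/ v = x) y ->
  exists a, in_span B (y - a *: x).
Proof.
move: y; apply: span_ind => [|a y z [c yc] [d zd]|y [By|->]].
- by exists 0; rewrite scale0r subr0; apply: span0.
- exists (a * c + d); rewrite scalerDl opprD addrACA -scalerA -scalerBr.
  exact: spanP.
- by exists 0; rewrite scale0r subr0; apply: span_gen.
- by exists 1; rewrite scale1r subrr; apply: span0.
Qed.

Lemma lin_indep_add B x : lin_indep B -> ~ in_span B x ->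
  lin_indep (fun v => B v \/ v = x).
Proof.
move=> iB nx s c us sB s0.
have sB' v : v \in s -> v != x -> B v by move=> /sB[//|->]; rewrite eqxx.
have [xs|xs] := boolP (x \in s); last first.
  by apply: iB => // v vs; apply: sB' => //; apply: contraNneq xs => <-.
move: s0; rewrite (bigD1_seq x) //= => /eqP; rewrite addr_eq0 => /eqP s0.
have cx0 : c x = 0.
  apply: contrapT => /eqP cx0; apply: nx.
  have -> : x = (c x)^-1 *: (c x *: x) by rewrite scalerK.
  rewrite s0; apply/spanZ/spanN; rewrite big_seq_cond; apply: span_sum => v /andP[vs vx].
  by apply/spanZ/span_gen/sB'.
move: s0; rewrite cx0 scale0r => /esym/eqP; rewrite oppr_eq0 -big_filter => /eqP s0.
move=> v vs; have [->//|vx] := eqVneq v x.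
apply: (iB _ c _ _ s0); [exact: filter_uniq| |by rewrite mem_filter vx].
by move=> w; rewrite mem_filter => /andP[wx ws]; apply: sB'.
Qed.

Lemma lin_indep_notin B x : lin_indep (fun v => B v \/ v = x) -> ~ B x -> ~ in_span B x.
Proof.
move=> iB nBx /span_uniq[s [c [us sB xs]]].
have xNs : x \notin s by apply/negP => /sB.
suff : (- 1 : F) = 0 by move/eqP; rewrite oppr_eq0 oner_eq0.
pose d v := if v == x then -1 else c v.
suff s0 : \sum_(v <- x :: s) d v *: v = 0.
  have := iB (x :: s) d _ _ s0 x (mem_head _ _); rewrite /d eqxx; apply.
    by rewrite /= xNs.
  by move=> v; rewrite inE => /predU1P[->|/sB]; [right|left].
rewrite big_cons {1}/d eqxx scaleN1r {1}xs addrC; apply/eqP; rewrite subr_eq0; apply/eqP.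
rewrite big_seq [RHS]big_seq; apply: eq_bigr => v vs; rewrite /d; case: eqP => // vx.
by rewrite -vx vs in xNs.
Qed.

Lemma lin_indep0 : lin_indep (fun _ : V => False).
Proof. by move=> s c _ s0 _ v /s0. Qed.

Lemma span_seq s x : in_span (fun v => v \in s) x ->
  exists c : 'I_(size s) -> F, x = \sum_i c i *: s`_i.
Proof.
move: x; apply: span_ind => [|a x y [c ->] [d ->]|x xs].
- by exists (fun=> 0); rewrite big1 // => i _; rewrite scale0r.
- exists (fun i => a * c i + d i); rewrite scaler_sumr -big_split.
  by apply: eq_bigr => i _; rewrite scalerDl scalerA.
- have ix : (index x s < size s)%N by rewrite index_mem.
  exists (fun i => (i == Ordinal ix)%:R).
  rewrite (bigD1 (Ordinal ix)) //= eqxx scale1r nth_index // big1 ?addr0 // => i /negbTE->.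
  by rewrite scale0r.
Qed.

Lemma lin_indep_seq s (c : 'I_(size s) -> F) : uniq s -> lin_indep (fun v => v \in s) ->
  \sum_i c i *: s`_i = 0 -> forall i, c i = 0.
Proof.
move=> us is0 s0 i.
pose d v := if insub (index v s) is Some j then c j else 0.
have dE (j : 'I_(size s)) : d s`_j = c j.
  by rewrite /d index_uniq // insubT // => p; congr c; apply: val_inj.
rewrite -dE; apply: (is0 s d) => //; last exact: mem_nth.
by rewrite (big_nth 0) big_mkord -[RHS]s0; apply: eq_bigr => j _; rewrite dE.
Qed.

(** If the bound failed, the coordinates of [s] in [t] would form a matrix with more rows than
    columns, and a non-zero vector of its left kernel is a linear relation on [s]. *)
Lemma steinitz s t : uniq s -> lin_indep (fun v => v \in s) ->
  (forall v, v \in s -> in_span (fun w => w \in t) v) -> (size s <= size t)%N.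
Proof.
move=> us is0 st; rewrite leqNgt; apply/negP => lt.
have /choice[A AE] : forall i : 'I_(size s), exists c : 'I_(size t) -> F,
    s`_i = \sum_j c j *: t`_j.
  by move=> i; apply/span_seq/st/mem_nth.
pose M := \matrix_(i < size s, j < size t) A i j.
have /rowV0Pn[w /sub_kermxP wM w0] : kermx M != 0.
  rewrite -mxrank_eq0 mxrank_ker subn_eq0 -ltnNge.
  exact: leq_ltn_trans (rank_leq_col _) lt.
move/negP: w0; apply; apply/eqP/rowP => i; rewrite mxE.
apply: (lin_indep_seq (c := fun i => w 0 i)) => //.
under eq_bigr => j _ do rewrite AE scaler_sumr.
rewrite exchange_big big1 //= => j _.
under eq_bigr => k _ do rewrite scalerA.
rewrite -scaler_suml; have /rowP/(_ j) := wM; rewrite !mxE.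
by under eq_bigr => k _ do rewrite mxE; move=> ->; rewrite scale0r.
Qed.

(** Used in three ways: [B] empty gives a basis inside [C], [C] everything gives a complement of the
    span of [B], and [C] a kernel keeps the added vectors inside that kernel. *)
Lemma basis_ext B C : lin_indep B -> exists T : V -> Prop,
  [/\ forall v, T v -> C v, forall v, T v -> ~ B v,
      lin_indep (fun v => B v \/ T v) &
      forall v, C v -> in_span (fun v => B v \/ T v) v].
Proof.
move=> iB.
pose Q s := (forall x, x \in s -> C x /\ ~ B x) /\ lin_indep (fun v => B v \/ v \in s).
have [|T [TQ Tmax]] := @zorn_finite_character _ Q.
  by split=> //; apply: lin_indep_sub iB => v [].
have TC v : T v -> C v /\ ~ B v.
  by move=> Tv; case: (TQ [:: v]) => [w|+ _]; [rewrite inE => /eqP->|apply; exact: mem_head].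
have iT : lin_indep (fun v => B v \/ T v).
  move=> s c us sT; case: (TQ [seq v <- s | `[< T v >]]) => [x|_ iQ].
    by rewrite mem_filter => /andP[/asboolP].
  apply: iQ => // v vs; have [|Tv] := sT v vs; first by left.
  by right; rewrite mem_filter vs andbT; apply/asboolP.
exists T; split=> [v /TC[]//|v /TC[]//|//|v Cv].
apply: contrapT => nv; have nT : ~ T v by move=> Tv; apply/nv/span_gen; right.
apply/nT/(Tmax (fun w => T w \/ w = v)); [by left| |by right].
move=> s sT; split.
  move=> x /sT[/TC//|->]; split=> // Bv; apply/nv/span_gen; by left.
apply: lin_indep_sub (lin_indep_add iT nv) => w [Bw|/sT[Tw|->]];
  [by left; left|by left; right|by right].
Qed.

(** Coordinates in a basis containing [B] are chosen for every vector; by independence any other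
    expression of the vector gives the same image, and linearity follows. *)
Lemma lin_ext (U : lmodType F) B (g : V -> U) : lin_indep B ->
  exists L : {linear V -> U}, forall v, B v -> L v = g v.
Proof.
move=> /(@basis_ext _ (fun=> True)) [T [_ _ iT sT]].
set B' := (X in lin_indep X) in iT.
suff [L LE] : exists L : {linear V -> U}, forall v, B' v -> L v = g v.
  by exists L => v Bv; apply: LE; left.
have /choice[p pP] : forall x, exists p : seq V * (V -> F), [/\ uniq p.1,
    forall v, v \in p.1 -> B' v & x = \sum_(v <- p.1) p.2 v *: v].
  by move=> x; have [s [c h]] := span_uniq (sT x I); exists (s, c).
pose L x := \sum_(v <- (p x).1) (p x).2 v *: g v.
have LE s c : uniq s -> (forall v, v \in s -> B' v) ->
    L (\sum_(v <- s) c v *: v) = \sum_(v <- s) c v *: g v.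
  move=> us sB; set x := \sum_(v <- s) _; rewrite /L.
  case: (p x) (pP x) => s' c' /= [us' sB' xE].
  pose r := undup (s ++ s'); have ur : uniq r by exact: undup_uniq.
  have sr : {subset s <= r} by move=> v vs; rewrite mem_undup mem_cat vs.
  have sr' : {subset s' <= r} by move=> v vs; rewrite mem_undup mem_cat vs orbT.
  rewrite (@sum_uniq_sub _ s r) // (@sum_uniq_sub _ s' r) //; apply/eqP; rewrite -subr_eq0 -sumrB; apply/eqP.
  rewrite big_seq big1 // => v vr; rewrite -scalerBl.
  rewrite (_ : _ - _ = 0) ?scale0r //.
  apply: (iT r (fun v => (if v \in s' then c' v else 0) - (if v \in s then c v else 0))) => //.
    by move=> w; rewrite mem_undup mem_cat => /orP[/sB|/sB'].
  under eq_bigr do rewrite scalerBl.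
  by rewrite sumrB -(@sum_uniq_sub _ s' r _ id) // -(@sum_uniq_sub _ s r _ id) // -xE subrr.
have Llin : linear L.
  move=> a x y; have [us sB xE] := pP x; have [us' sB' yE] := pP y.
  pose r := undup ((p x).1 ++ (p y).1); have ur : uniq r by exact: undup_uniq.
  have sr : {subset (p x).1 <= r} by move=> v vs; rewrite mem_undup mem_cat vs.
  have sr' : {subset (p y).1 <= r} by move=> v vs; rewrite mem_undup mem_cat vs orbT.
  rewrite {1}xE {1}yE (@sum_uniq_sub _ _ r _ id us) // (@sum_uniq_sub _ _ r _ id us') // scaler_sumr -big_split /=.
  under eq_bigr do rewrite scalerA -scalerDl.
  rewrite LE //; last by move=> w; rewrite mem_undup mem_cat => /orP[/sB|/sB'].
  rewrite /L (@sum_uniq_sub _ _ r _ g us) // (@sum_uniq_sub _ _ r _ g us') // scaler_sumr -big_split /=.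
  by apply: eq_bigr => v _; rewrite scalerDl scalerA.
exists (mklin Llin) => v Bv /=.
have := LE [:: v] (fun=> 1) isT; rewrite !big_seq1 !scale1r; apply.
by move=> w; rewrite inE => /eqP->.
Qed.

(* Each member of a spanning family has finite support in a basis, and these
   supports cover the basis. *)
Lemma lin_indep_le_set (B C : V -> Prop) (h : nat -> V -> V) : lin_indep B -> infset C ->
  (forall x, B x -> in_span (fun y => exists i v, C v /\ y = h i v) x) -> le_set B C.
Proof.
move=> iB infC BC; pose G y := exists i v, C v /\ y = h i v.
have [T [TG TB iT sT]] := @basis_ext B G iB.
set B' := (X in lin_indep X) in iT.
suff : le_set B' C by apply: le_set_trans; apply: le_set_sub => v; left.
have /choice[p pP] : forall x, exists s : seq V, G x -> in_span (fun v => v \in s /\ B' v) x.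
  move=> x; have [/sT[s [c [sB ->]]]|] := pselect (G x); last by exists [::].
  exists s => _; rewrite big_seq; apply: span_sum => v vs.
  by apply/spanZ/span_gen; split=> //; apply: sB.
pose B1 v := B' v /\ exists i w, C w /\ v \in p (h i w).
have cov v : B' v -> B1 v.
  move=> B'v; apply: contrapT => nB1.
  have iB1 : lin_indep (fun w => B1 w \/ w = v).
    by apply: lin_indep_sub iT => w [[]|->].
  apply: (lin_indep_notin iB1 nB1); apply: (@span_sub G).
    move=> w Gw; have [i [x [Cx wE]]] := Gw; apply: span_mono (pP w Gw) => z [zp B'z].
    by split=> //; exists i, x; rewrite -wE.
  by case: B'v => [/BC|/TG /span_gen].
apply: le_set_trans (infset_prod_nat infC).
pose dec n : nat * nat := odflt (0, 0)%N (unpickle n).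
apply: (@le_set_image _ _ _ _
  (fun q : V * nat => nth 0 (p (h (dec q.2).1 q.1)) (dec q.2).2) (0, 0%N)) => v /cov.
move=> [_ [i [w [Cw vp]]]]; exists (w, pickle (i, index v (p (h i w)))) => //=.
by rewrite /dec pickleK /= nth_index.
Qed.
End Span.

(** * Gradings and chains *)

Section ThreeSquareZero.
Variables (F : fieldType) (V : lmodType F).
Implicit Types (B : V -> Prop) (u : {linear V -> V}).

Lemma lin_ext_fam (U : lmodType F) (T : Type) (I : T -> Prop) (b : T -> V) (g : T -> U) :
  (forall t t', I t -> I t' -> b t = b t' -> t = t') ->
  lin_indep (fun v => exists t, I t /\ v = b t) ->
  exists L : {linear V -> U}, forall t, I t -> L (b t) = g t.
Proof.
move=> binj ib.
have /choice[g' g'P] : forall v, exists z, forall t, I t -> v = b t -> z = g t.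
  move=> v; have [[t [It vt]]|nt] := pselect (exists t, I t /\ v = b t).
    by exists (g t) => t' It' vt'; rewrite (binj t t') // -vt.
  by exists 0 => t It vt; case: nt; exists t.
have [L LE] := lin_ext g' ib; exists L => t It.
by rewrite LE; [apply: g'P|exists t].
Qed.

(** Only the restrictions to [W] of the three maps matter; keeping them defined on [V] avoids a type
    for the subspace. *)
Definition three_square_zero_on u (W : V -> Prop) : Prop :=
  exists a b c : {linear V -> V},
    [/\ forall x, W x -> [/\ W (a x), W (b x) & W (c x)],
        forall x, W x -> [/\ a (a x) = 0, b (b x) = 0 & c (c x) = 0]
      & forall x, W x -> u x = a x + b x + c x].

(* [P] is the projection onto the even part of a grading modulo 2 for which
   [u - c] is odd; an odd endomorphism is the sum of its two restrictions. *)
Lemma three_square_zero_of_grading B u (P c : {linear V -> V}) :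
  (forall x, B x -> [/\ in_span B (u x), in_span B (P x) & in_span B (c x)]) ->
  (forall x, B x -> [/\ P (P x) = P x, c (c x) = 0 &
     P (u x - c x) = u (x - P x) - c (x - P x)]) ->
  three_square_zero_on u (in_span B).
Proof.
move=> BW BE; pose v : {linear V -> V} := (u \- c).
pose a : {linear V -> V} := (v \o P).
have uW x : in_span B x -> in_span B (u x) by apply: span_lin => y /BW[].
have PW x : in_span B x -> in_span B (P x) by apply: span_lin => y /BW[].
have cW x : in_span B x -> in_span B (c x) by apply: span_lin => y /BW[].
have vW x : in_span B x -> in_span B (v x).
  by move=> Wx; apply: spanB; [apply: uW|apply: cW].
have PP x : in_span B x -> P (P x) = P x by apply: (@span_eq _ _ _ (P \o P) P) => y /BE[].
have cc x : in_span B x -> c (c x) = 0.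
  by apply: (@span_eq _ _ _ (c \o c) \0) => y /BE[].
have Pv x : in_span B x -> P (v x) = v x - v (P x).
  apply: (@span_eq _ _ _ (P \o v) (v \- (v \o P))) => y /BE[_ _ e].
  by rewrite [LHS]e [RHS]/= !linearB /=; lmod V.
pose b : {linear V -> V} := (v \- a).
have bE y : b y = v y - v (P y) by [].
exists a, b, c; split=> x Wx.
- by split; [apply/vW/PW|rewrite bE; apply: spanB; [exact: vW|apply/vW/PW]|exact: cW].
- split; [|rewrite (bE x) -Pv // bE PP ?subrr //; exact: vW|exact: cc].
  have -> : a (a x) = v (P (v (P x))) by [].
  by rewrite Pv ?PP ?subrr ?linear0 //; apply: PW.
- rewrite bE; have -> : a x = v (P x) by []; have -> : v x = u x - c x by [].
  by lmod V.
Qed.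

(** [V] is the direct sum of the two spans, so maps chosen on each of them combine. *)
Lemma three_square_zero_glue B B' u :
  lin_indep (fun v => B v \/ B' v) -> (forall v, B v -> ~ B' v) ->
  (forall x, in_span (fun v => B v \/ B' v) x) ->
  three_square_zero_on u (in_span B) -> three_square_zero_on u (in_span B') ->
  exists a b c : {linear V -> V},
    [/\ square_zero a, square_zero b, square_zero c & forall x, u x = a x + b x + c x].
Proof.
move=> iBB dBB sBB [a [b [c [W0 W1 W2]]]] [a' [b' [c' [W0' W1' W2']]]].
have glue (f f' : {linear V -> V}) : exists g : {linear V -> V},
    (forall x, in_span B x -> g x = f x) /\ (forall x, in_span B' x -> g x = f' x).
  have [g gE] := lin_ext (fun v => if `[< B v >] then f v else f' v) iBB.
  exists g; split; apply: span_eq => x Bx; rewrite gE; try by [left|right].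
    by case: asboolP.
  by case: asboolP => // /dBB.
have sq (f f' g : {linear V -> V}) : (forall x, in_span B x -> in_span B (f x)) ->
    (forall x, in_span B' x -> in_span B' (f' x)) ->
    (forall x, in_span B x -> f (f x) = 0) -> (forall x, in_span B' x -> f' (f' x) = 0) ->
    (forall x, in_span B x -> g x = f x) /\ (forall x, in_span B' x -> g x = f' x) ->
    square_zero g.
  move=> fW fW' ff ff' [gE gE'] x.
  apply: (@span_eq _ _ _ (g \o g) \0 _ _ x (sBB x)) => y /= [/span_gen By|/span_gen By].
    by rewrite (gE y) // gE ?ff //; apply: fW.
  by rewrite (gE' y) // gE' ?ff' //; apply: fW'.
have [a1 Ea] := glue a a'; have [b1 Eb] := glue b b'; have [c1 Ec] := glue c c'.
exists a1, b1, c1; split=> [||| x].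
- by apply: sq Ea => x Wx; [case: (W0 x)|case: (W0' x)|case: (W1 x)|case: (W1' x)].
- by apply: sq Eb => x Wx; [case: (W0 x)|case: (W0' x)|case: (W1 x)|case: (W1' x)].
- by apply: sq Ec => x Wx; [case: (W0 x)|case: (W0' x)|case: (W1 x)|case: (W1' x)].
- apply: (@span_eq _ _ _ u (a1 \+ b1 \+ c1) _ _ x (sBB x)) => y /= [/span_gen By|/span_gen By].
    by rewrite Ea.1 ?Eb.1 ?Ec.1 ?W2.
  by rewrite Ea.2 ?Eb.2 ?Ec.2 ?W2'.
Qed.

(* The vectors [b a k], [I a k], form chains [b a k.+1 |-> b a k]; on the span
   of the chain ends, the relevant block of [u] is a commutator [J R - R J]
   where [R] avoids the ends of the chains of length one. *)
Lemma three_square_zero_of_chains (A : Type) (I : A -> nat -> Prop) (b : A -> nat -> V)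
    u (J R : {linear V -> V}) :
  (forall a k, I a k.+1 -> I a k) ->
  (forall a k a' k', I a k -> I a' k' -> b a k = b a' k' -> a = a' /\ k = k') ->
  lin_indep (fun v => exists a k, I a k /\ v = b a k) ->
  (forall a k, I a k.+1 -> u (b a k.+1) = b a k) ->
  (forall a, I a 0%N -> in_span (fun v => exists a, I a 0%N /\ v = b a 0%N) (J (b a 0%N))) ->
  (forall a, I a 0%N -> in_span (fun v => exists a, I a 1%N /\ v = b a 0%N) (R (b a 0%N))) ->
  (forall a, I a 0%N -> in_span (fun v => exists a k, I a k.+1 /\ v = b a k.+1)
     (u (b a 0%N) - (J (R (b a 0%N)) - R (J (b a 0%N))))) ->
  three_square_zero_on u (in_span (fun v => exists a k, I a k /\ v = b a k)).
Proof.
move=> Idown binj ib ub JY RY uY.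
set B := fun v => exists a k, I a k /\ v = b a k.
pose Y v := exists a, I a 0%N /\ v = b a 0%N.
pose Y1 v := exists a, I a 1%N /\ v = b a 0%N.
pose Bp v := exists a k, I a k.+1 /\ v = b a k.+1.
pose X1 v := exists a, I a 1%N /\ v = b a 1%N.
have ext (g : A -> nat -> V) : exists L : {linear V -> V},
    forall a k, I a k -> L (b a k) = g a k.
  have [||L LE] := @lin_ext_fam V (A * nat) (fun p => I p.1 p.2) (fun p => b p.1 p.2)
    (fun p => g p.1 p.2).
  - by move=> [a k] [a' k'] /= Ik Ik' /(binj _ _ _ _ Ik Ik')[-> ->].
  - by apply: lin_indep_sub ib => v [[a k] /= h]; exists a, k.
  - by exists L => a k Ik; apply: (LE (a, k)).
(* [X] inverts [u] on the ends of the chains of length at least two; its values on the other ends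
   are junk, and [R] avoids them. *)
have [X XE] := ext (fun a k => if k is 0%N then b a 1%N else 0).
have [S SE] : exists S : {linear V -> V}, forall w, S w = R (J w) by exists (R \o J).
(* The even part is spanned by the [b a k] with [k] odd. The odd part is spanned by the [b a k] with
   [k] even and positive and by the sheared ends [y + X (S y)], which this value of [P] kills. *)
have [P PE] := ext (fun a k => if k is 0%N then - X (S (b a 0%N)) else
  if odd k then b a k else 0).
(* In the sheared basis, [pi] sends [y + X (S y)] to [y] and [X y] to [- J y]. *)
have [pi piE] := ext (fun a k => match k with
  | 0%N => b a 0%N + J (S (b a 0%N)) | 1%N => - J (b a 0%N) | _ => 0 end).
have [Ev EvE] := ext (fun a k => if k is 0%N then 0 else if odd k then 0 else b a k).
(* The first term is the even component of [rho w], and the next two are the shear of [J (R w)]. The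
   last copies the components of [u w] that lie in the odd part beyond the chain ends. Then
   [pi (rho w) = 0], and the blocks of [rho] after [pi] are [- R J] on the [X y] and [J R] on the
   sheared ends. *)
have [rho rhoE] : exists rho : {linear V -> V}, forall w,
    rho w = X (R w) + J (R w) + X (S (J (R w))) + Ev (u w).
  by exists ((X \o R) \+ (J \o R) \+ (X \o S \o J \o R) \+ (Ev \o u)).
have [c cE] : exists c : {linear V -> V}, forall w, c w = rho (pi w) by exists (rho \o pi).
have JW w : in_span Y w -> in_span Y (J w) by apply: span_lin => _ [a [Ia ->]]; apply: JY.
have RW w : in_span Y w -> in_span Y1 (R w) by apply: span_lin => _ [a [Ia ->]]; apply: RY.
have Y1Y w : in_span Y1 w -> in_span Y w.
  by apply: span_mono => _ [a [Ia ->]]; exists a; split=> //; apply: Idown.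
have YB w : in_span Y w -> in_span B w.
  by apply: span_mono => _ [a [Ia ->]]; exists a, 0%N.
have SW w : in_span Y w -> in_span Y1 (S w) by rewrite SE => /JW /RW.
have BpB w : in_span Bp w -> in_span B w.
  by apply: span_mono => _ [a [k [Ia ->]]]; exists a, k.+1.
have X1E w : in_span Y1 w -> in_span X1 (X w).
  apply: span_lin => _ [a [Ia ->]]; rewrite XE; last exact: Idown.
  by apply: span_gen; exists a.
have X1B w : in_span X1 w -> in_span B w.
  by apply: span_mono => _ [a [Ia ->]]; exists a, 1%N.
have piX w : in_span Y1 w -> pi (X w) = - J w.
  apply: (@span_eq _ _ _ (pi \o X) (\- J)) => _ [a [Ia ->]] /=.
  by rewrite XE ?piE //; apply: Idown.
have uX w : in_span Y1 w -> u (X w) = w.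
  apply: (@span_eq _ _ _ (u \o X) idfun) => _ [a [Ia ->]] /=.
  by rewrite XE ?ub //; apply: Idown.
have PX w : in_span Y1 w -> P (X w) = X w.
  apply: (@span_eq _ _ _ (P \o X) X) => _ [a [Ia ->]] /=.
  by rewrite XE ?PE //; apply: Idown.
have PY w : in_span Y w -> P w = - X (S w).
  by apply: (@span_eq _ _ _ P (\- (X \o S))) => _ [a [Ia ->]]; rewrite PE.
have piY w : in_span Y w -> pi w = w + J (S w).
  by apply: (@span_eq _ _ _ pi (idfun \+ (J \o S))) => _ [a [Ia ->]]; rewrite piE.
have EvB w : in_span B w -> in_span Bp (Ev w).
  apply: span_lin => _ [a [k [Ik ->]]]; rewrite EvE //; case: k Ik => [|k] Ik; first exact: span0.
  by case: ifP => _; [exact: span0|apply: span_gen; exists a, k].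
have piEv w : in_span B w -> pi (Ev w) = 0.
  apply: (@span_eq _ _ _ (pi \o Ev) \0) => _ [a [k [Ik ->]]] /=; rewrite EvE //.
  by case: k Ik => [|[|k]] Ik; rewrite /= ?linear0 //; case: ifP => _; rewrite ?linear0 ?piE.
have PEv w : in_span B w -> P (Ev w) = 0.
  apply: (@span_eq _ _ _ (P \o Ev) \0) => _ [a [k [Ik ->]]] /=; rewrite EvE //.
  case: k Ik => [|k] Ik; rewrite ?linear0 //; case: ifP => ok; rewrite ?linear0 // PE //.
  by rewrite ok.
have EvY w : in_span Y w -> Ev w = 0.
  by apply: (@span_eq _ _ _ Ev \0) => _ [a [Ia ->]]; rewrite EvE.
have EvP w : in_span Bp w -> Ev w = w - P w.
  apply: (@span_eq _ _ _ Ev (idfun \- P)) => _ [a [k [Ik ->]]] /=; rewrite EvE // PE //.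
  by rewrite /= fun_if if_neg; case: ifP => _; rewrite ?subrr ?subr0.
(* [D] is the block of [u] on the chain ends; the remainder [t] of [u] lands in [Bp] by
   hypothesis. *)
have [D DE] : exists D : {linear V -> V}, forall w, D w = J (R w) - S w.
  by exists ((J \o R) \- S).
have DW w : in_span Y w -> in_span Y (D w).
  by move=> Yw; rewrite DE; apply: spanB; [apply/JW/Y1Y/RW|apply/Y1Y/SW].
have [t tE] : exists t : {linear V -> V}, forall w, t w = u w - D w by exists (u \- D).
have uE w : u w = D w + t w by rewrite tE; lmod V.
have tW w : in_span Y w -> in_span Bp (t w).
  by apply: span_lin => _ [a [Ia ->]]; rewrite tE DE SE; apply: uY.
have uW w : in_span Y w -> in_span B (u w).
  by move=> Yw; rewrite uE; apply: spanD; [apply/YB/DW|apply/BpB/tW].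
have Evu w : in_span Y w -> Ev (u w) = t w - P (t w).
  by move=> Yw; rewrite uE linearD EvY ?add0r ?EvP //; [apply: tW|apply: DW].
have rhoW w : in_span Y w -> in_span B (rho w).
  move=> Yw; rewrite rhoE; have JRw := JW _ (Y1Y _ (RW _ Yw)).
  apply: spanD; last by apply/BpB/EvB/uW.
  apply: spanD; last by apply/X1B/X1E/SW.
  by apply: spanD; [apply/X1B/X1E/RW|apply: YB].
have piW a k : I a k -> in_span Y (pi (b a k)).
  case: k => [|[|k]] Ik; rewrite piE //; last exact: span0.
    have Yb : in_span Y (b a 0%N) by apply: span_gen; exists a.
    by apply: spanD => //; apply/JW/Y1Y/SW.
  by apply/spanN/JY/Idown.
have pirho w : in_span Y w -> pi (rho w) = 0.
  move=> Yw; have JRw := JW _ (Y1Y _ (RW _ Yw)).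
  rewrite rhoE !linearD piX ?(piY (J _)) ?piX ?piEv //; first by lmod V.
  - exact: uW.
  - exact: SW.
  - exact: RW.
have Prho w : in_span Y w -> P (rho w) = X (R w).
  move=> Yw; have JRw := JW _ (Y1Y _ (RW _ Yw)).
  rewrite rhoE !linearD PX ?(PY (J _)) ?PX ?PEv //; first by lmod V.
  - exact: uW.
  - exact: SW.
  - exact: RW.
apply: (@three_square_zero_of_grading B u P c) => _ [a [k [Ik ->]]].
  split.
  - case: k Ik => [|k] Ik; first by apply: uW; apply: span_gen; exists a.
    by rewrite ub //; apply: span_gen; exists a, k; split=> //; apply: Idown.
  - rewrite PE //; case: k Ik => [|k] Ik.
      by apply/spanN/X1B/X1E/SW/span_gen; exists a.
    by case: ifP => _; [apply: span_gen; exists a, k.+1|apply: span0].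
  - by rewrite cE; apply/rhoW/piW.
split; last first.
- case: k Ik => [|[|k]] Ik.
  + have Yy : in_span Y (b a 0%N) by apply: span_gen; exists a.
    move: (b a 0%N) Yy => y Yy {Ik}.
    have SY := SW _ Yy; have JSY := JW _ (Y1Y _ SY).
    rewrite (PY y) // opprK !cE (linearD pi y) piX // (piY y) // addrK.
    rewrite linearB Prho; last exact: spanD.
    rewrite rhoE Evu // (linearD u y) uX // uE (linearD P (D y)) (PY (D y)); last exact: DW.
    have -> : S (D y) = R (J (J (R y))) - R (J (S y)) by rewrite DE !SE !linearB.
    rewrite [S (J (R y))]SE.
    have -> : R (y + J (S y)) = R y + R (J (S y)) by rewrite linearD.
    by rewrite DE (linearB X) (linearD X); lmod V.
  + have Yy : in_span Y (b a 0%N) by apply: span_gen; exists a; split=> //; apply: Idown.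
    rewrite PE // subrr (linear0 u) (linear0 c) subr0 ub // linearB PY // cE piE // linearN linearN Prho.
      by rewrite SE; lmod V.
    exact: JW.
  + have c0 : c (b a k.+2) = 0 by rewrite cE piE // linear0.
    rewrite c0 subr0 ub // !PE //=; last exact: Idown.
    by case: (odd k); rewrite /= ?subrr ?subr0 ?(linear0 u) ?(linear0 c) ?c0 ?subr0 ?ub.
- by rewrite cE [c _]cE pirho ?linear0 //; apply: piW.
- case: k Ik => [|k] Ik; rewrite PE //.
    by rewrite linearN PX //; apply/SW/span_gen; exists a.
  by case: ifP => ok; rewrite ?linear0 // PE // ok.
Qed.

End ThreeSquareZero.

(** * Scalar parts and chains for an infinite or finite family *)

Section Chains.
Variables (F : fieldType) (V : lmodType F).
Implicit Types (B : V -> Prop) (u : {linear V -> V}).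

(* In characteristic 2, [c] sends both members of a pair of basis vectors to
   [lam] times their sum. *)
Lemma three_square_zero_scalar (T : V -> Prop) u (lam : F) :
  lin_indep T -> (forall v, T v -> u v = lam *: v) -> lam + lam = 0 ->
  lam = 0 \/ infset T -> three_square_zero_on u (in_span T).
Proof.
move=> iT uT lam2 [lam0|infT].
  exists \0, \0, \0; split=> x Wx; rewrite /= ?addr0.
  - by split; exact: span0.
  - by [].
  - by apply: (@span_eq _ _ _ u \0 _ _ x Wx) => y /uT ->; rewrite lam0 scale0r.
(* Since [T] is infinite, it is in bijection with [T * bool], which arranges the basis in pairs. *)
have [th [thT thi ths]] : exists th : V * bool -> V, [/\ forall p, T p.1 -> T (th p),
    forall p q, T p.1 -> T q.1 -> th p = th q -> p = q
    & forall y, T y -> exists2 p, T p.1 & th p = y].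
  apply: (@le_set_antisym _ _ (fun p : V * bool => T p.1) T 0).
    apply: le_set_trans (infset_prod_nat infT).
    exists (fun p => (p.1, nat_of_bool p.2)); split=> // -[x e] [y e'] _ _ /= [->].
    by case: e e' => [] [].
  by exists (fun v => (v, true)); split=> // x y _ _ [].
have ext (g : V * bool -> V) : exists L : {linear V -> V}, forall p, T p.1 -> L (th p) = g p.
  apply: lin_ext_fam => //; apply: lin_indep_sub iT => _ [p [Tp ->]]; exact: thT.
have [P PE] := ext (fun p => if p.2 then th p else 0).
have [c cE] := ext (fun p => lam *: (th (p.1, true) + th (p.1, false))).
have lin (L : {linear V -> V}) x : L (lam *: x) = lam *: L x by rewrite linearZ.
apply: (@three_square_zero_of_grading _ _ T u P c) => x Tx; rewrite uT //;
  have [[v e] /= Tv <-] := ths x Tx; rewrite PE // cE //=.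
  split; first by apply/spanZ/span_gen/thT.
    by case: e; [apply/span_gen/thT|exact: span0].
  by apply/spanZ/spanD; apply/span_gen/thT.
split.
- by case: e; rewrite ?linear0 ?PE.
- by rewrite lin (linearD c) !cE //= -scalerDl lam2 scale0r scaler0.
- rewrite (linearB P) !lin (linearD P) !PE //=; case: e => /=.
    by rewrite subrr (linear0 u) (linear0 c); lmod V.
  rewrite subr0 uT ?cE //=; last exact: thT.
  by lmod V.
Qed.

(** As [X] is equipotent with [X * nat], the chains can be indexed by some [j] in [X] and a level
    [n], with all chains of length one on level 0. [J] lowers the level and [N] raises it, so [J N]
    is the identity on the ends. Hence the commutator equation is solved for [R] level by level, and
    [R] never reaches level 0. *)
Lemma three_square_zero_infinite (X Z : V -> Prop) u :
  infset X -> le_set Z X ->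
  (forall x y, X x -> X y -> u x = u y -> x = y) -> (forall x y, X x -> X y -> x <> u y) ->
  (forall x, X x -> ~ Z x /\ ~ Z (u x)) ->
  let D v := (X v \/ exists x, X x /\ v = u x) \/ Z v in
  lin_indep D -> (forall v, D v -> in_span D (u v)) -> three_square_zero_on u (in_span D).
Proof.
move=> infX ZX uinj Xu XZ D iD uD.
have [be [beX bei bes]] : exists be : V * nat -> V, [/\ forall p, X p.1 -> X (be p),
    forall p q, X p.1 -> X q.1 -> be p = be q -> p = q
    & forall y, X y -> exists2 p, X p.1 & be p = y].
  apply: (@le_set_antisym _ _ (fun p : V * nat => X p.1) X 0).
    exact: infset_prod_nat.
  by exists (fun v => (v, 0%N)); split=> // x y _ _ [].
(* The pairs of level 0 are dissolved into single vectors, so that the chains of length one are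
   exactly as numerous as [X], however small [Z] is. *)
pose Z' v := (exists j, X j /\ v = be (j, 0%N)) \/ (exists j, X j /\ v = u (be (j, 0%N))) \/ Z v.
have [ze [zeZ zei zes]] : exists ze : V -> V, [/\ forall x, X x -> Z' (ze x),
    forall x y, X x -> X y -> ze x = ze y -> x = y
    & forall y, Z' y -> exists2 x, X x & ze x = y].
  apply: (@le_set_antisym _ _ X Z' 0).
    exists (fun j => be (j, 0%N)); split=> [j Xj|x y Xx Xy /bei]; first by left; exists j.
    by move=> /(_ Xx Xy)[].
  apply: le_set_or => //; last apply: le_set_or => //.
    by apply: (le_set_image (h := fun j => be (j, 0%N)) 0) => _ [j [Xj ->]]; exists j.
  by apply: (le_set_image (h := fun j => u (be (j, 0%N))) 0) => _ [j [Xj ->]]; exists j.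
pose I (a : V * nat) (k : nat) := X a.1 /\ (k <= (0 < a.2))%N.
pose b (a : V * nat) (k : nat) := if a.2 is 0%N then ze a.1 else
  if k is 0%N then u (be a) else be a.
have nZ' j n : X j -> ~ Z' (be (j, n.+1)).
  move=> Xj; case=> [[i [Xi]]|[[i [Xi]]|Zb]].
  - by move=> /(bei (j, n.+1) (i, 0%N) Xj Xi).
  - by apply: Xu; apply: beX.
  - by case: (XZ (be (j, n.+1))) => //; apply: beX.
have nuZ' j n : X j -> ~ Z' (u (be (j, n.+1))).
  move=> Xj; case=> [[i [Xi]]|[[i [Xi]]|Zb]].
  - by move=> /esym; apply: Xu; apply: beX.
  - by move=> /(uinj _ _ (beX (j, n.+1) Xj) (beX (i, 0%N) Xi)) /(bei (j, n.+1) (i, 0%N) Xj Xi).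
  - by case: (XZ (be (j, n.+1))) => //; apply: beX.
have DE : D = (fun v => exists a k, I a k /\ v = b a k).
  apply/funext => v; apply/propext; split; last first.
    move=> [[j [|n]] [[|k] [[/= Xj kn] ->]]]; rewrite /b //=.
    - case: (zeZ j Xj) => [[i [Xi ->]]|[[i [Xi ->]]|?]]; last by right.
        by left; left; apply: beX.
      by left; right; exists (be (i, 0%N)); split=> //; apply: beX.
    - by left; right; exists (be (j, n.+1)); split=> //; apply: beX.
    - by left; left; apply: beX.
  have Z'I w : Z' w -> exists a k, I a k /\ w = b a k.
    by move=> /zes[j Xj <-]; exists (j, 0%N), 0%N.
  move=> [[/bes[[j [|n]] Xj <-]|[_ [/bes[[j [|n]] Xj <-] ->]]]|Zv].
  - by apply: Z'I; left; exists j.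
  - by exists (j, n.+1), 1%N.
  - by apply: Z'I; right; left; exists j.
  - by exists (j, n.+1), 0%N.
  - by apply: Z'I; right; right.
have Idown a k : I a k.+1 -> I a k by move=> [? /ltnW].
have binj a k a' k' : I a k -> I a' k' -> b a k = b a' k' -> a = a' /\ k = k'.
  case: a => j [|n]; case: a' => j' [|n'] [/= Xj Ik] [/= Xj' Ik']; rewrite /b /=.
  - move=> /(zei _ _ Xj Xj') ->; move: Ik Ik'; rewrite !leqn0 => /eqP -> /eqP ->; by [].
  - move=> e; exfalso; move: (zeZ j Xj); rewrite e; case: (k') => [|?]; [exact: nuZ'|exact: nZ'].
  - move=> e; exfalso; move: (zeZ j' Xj'); rewrite -e; case: (k) => [|?]; [exact: nuZ'|exact: nZ'].
  - case: k k' Ik Ik' => [|[|//]] [|[|//]] _ _.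
    + by move=> /(uinj _ _ (beX (_, _) Xj) (beX (_, _) Xj')) /(bei (_, _) (_, _) Xj Xj') ->.
    + by move=> /esym /(Xu _ _ (beX (_, _) Xj') (beX (_, _) Xj)).
    + by move=> /(Xu _ _ (beX (_, _) Xj) (beX (_, _) Xj')).
    + by move=> /(bei (_, _) (_, _) Xj Xj') ->.
rewrite DE in iD uD *; set B := (X in in_span X) in uD *.
have ext (g : V * nat -> nat -> V) : exists L : {linear V -> V},
    forall a k, I a k -> L (b a k) = g a k.
  have [||L LE] := @lin_ext_fam _ _ V ((V * nat) * nat) (fun p => I p.1 p.2)
    (fun p => b p.1 p.2) (fun p => g p.1 p.2).
  - by move=> [a k] [a' k'] /= Ik Ik' /(binj _ _ _ _ Ik Ik')[-> ->].
  - by apply: lin_indep_sub iD => v [[a k] /= h]; exists a, k.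
  - by exists L => a k Ik; apply: (LE (a, k)).
have [J JE] := ext (fun a k => if a.2 is n.+1 then b (a.1, n) 0%N else 0).
have [N NE] := ext (fun a k => b (a.1, a.2.+1) 0%N).
have [pY pE] := ext (fun a k => if k is 0%N then b a 0%N else 0).
(* [M j n] is the required value of [J R] on the end of chain [(j, n)]: the block of [u] there plus
   [R J], which is [R] on the end one level below. *)
pose M j := fix M n := if n is n'.+1 then N (M n') + pY (u (b (j, n) 0%N))
                       else pY (u (b (j, 0%N) 0%N)).
have [R RE] := ext (fun a k => N (M a.1 a.2)).
pose Y v := exists a, I a 0%N /\ v = b a 0%N.
pose Y1 v := exists a, I a 1%N /\ v = b a 0%N.
have Y1Y v : in_span Y1 v -> in_span Y v.
  by apply: span_mono => _ [a [Ia ->]]; exists a; split=> //; apply: Idown.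
have pYY v : in_span B v -> in_span Y (pY v).
  apply: span_lin => _ [a [[|k] [Ik ->]]]; rewrite pE //; last exact: span0.
  by apply: span_gen; exists a.
have NY v : in_span Y v -> in_span Y1 (N v).
  apply: span_lin => _ [[j n] [Ia ->]]; rewrite NE //; apply: span_gen.
  by exists (j, n.+1); split=> //; case: Ia => Xj _; split.
have JN v : in_span Y v -> J (N v) = v.
  apply: (@span_eq _ _ _ (J \o N) idfun) => _ [[j n] [Ia ->]] /=.
  by rewrite NE // JE //=; case: Ia => Xj _; split.
have MY j n : X j -> in_span Y (M j n).
  move=> Xj; have uY m : in_span Y (pY (u (b (j, m) 0%N))).
    by apply/pYY/uD; exists (j, m), 0%N.
  by elim: n => [|n IH] //=; apply: spanD => //; apply/Y1Y/NY.
apply: (@three_square_zero_of_chains _ _ _ I b u J R) => //.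
- move=> [j [|n]] [|k] [/= Xj kn]; rewrite /b //=; by case: k kn.
- move=> [j [|n]] [/= Xj _]; rewrite JE //=; first exact: span0.
  by apply: span_gen; exists (j, n).
- by move=> [j n] [/= Xj _]; rewrite RE //; apply/NY/MY.
- move=> [j n] [/= Xj _]; rewrite RE //= JN; last exact: MY.
  have -> : M j n - R (J (b (j, n) 0%N)) = pY (u (b (j, n) 0%N)).
    case: n => [|n]; rewrite JE //=; first by rewrite linear0 subr0.
    by rewrite RE // addrC addKr.
  have : in_span B (u (b (j, n) 0%N)) by apply: uD; exists (j, n), 0%N.
  move: (u _); apply: span_ind => [|x v w hv hw|_ [a [[|k] [Ik ->]]]].
  + by rewrite linear0 subr0; exact: span0.
  + by rewrite linearP opprD addrACA -scalerBr; apply: spanP.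
  + by rewrite pE // subrr; exact: span0.
  + by rewrite pE // subr0; apply: span_gen; exists a, k.
Qed.
End Chains.

Section FiniteChains.
Variables (F : fieldType) (V : lmodType F).
Implicit Types (B : V -> Prop) (u : {linear V -> V}).

(* Modulo the chains of smaller index [u (b i 0)] is [d i *: b i 0]; the
   recursion for [R] closes up because the trace vanishes. *)
Lemma three_square_zero_finite (r : nat) (l : nat -> nat) (b : nat -> nat -> V) u (d : nat -> F) :
  let I i k := (i < r)%N /\ (k <= l i)%N in
  let B v := exists i k, I i k /\ v = b i k in
  (forall i k i' k', I i k -> I i' k' -> b i k = b i' k' -> i = i' /\ k = k') ->
  lin_indep B -> (forall i, (0 < i < r)%N -> (0 < l i)%N) ->
  (forall i k, I i k.+1 -> u (b i k.+1) = b i k) ->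
  (forall i, (i < r)%N -> in_span (fun v => exists j k, [/\ I j k, (j < i)%N \/ (0 < k)%N & v = b j k])
     (u (b i 0%N) - d i *: b i 0%N)) ->
  \sum_(i < r) d i = 0 -> three_square_zero_on u (in_span B).
Proof.
move=> I B binj iB l0 ub ud tr0.
have Idown i k : I i k.+1 -> I i k by move=> [? /ltnW].
have ext (g : nat -> nat -> V) : exists L : {linear V -> V},
    forall i k, I i k -> L (b i k) = g i k.
  have [||L LE] := @lin_ext_fam _ _ V (nat * nat) (fun p => I p.1 p.2)
    (fun p => b p.1 p.2) (fun p => g p.1 p.2).
  - by move=> [a k] [a' k'] /= Ik Ik' /(binj _ _ _ _ Ik Ik')[-> ->].
  - by apply: lin_indep_sub iB => v [[a k] /= h]; exists a, k.
  - by exists L => a k Ik; apply: (LE (a, k)).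
have [J JE] := ext (fun i k => if i is j.+1 then b j 0%N else 0).
have [N NE] := ext (fun i k => if (i.+1 < r)%N then b i.+1 0%N else 0).
have [pY pE] := ext (fun i k => if k is 0%N then b i 0%N else 0).
pose M := fix M i := if i is j.+1 then N (M j) + pY (u (b i 0%N)) else pY (u (b 0 0)%N).
have [R RE] := ext (fun i k => N (M i)).
pose Yl i v := exists j, (j < i)%N /\ v = b j 0%N.
have I0 i : (i < r)%N -> I i 0%N by move=> ir; split.
have uY i : (i < r)%N -> in_span (Yl i) (pY (u (b i 0%N)) - d i *: b i 0%N).
  move=> ir; have -> : d i *: b i 0%N = pY (d i *: b i 0%N) by rewrite linearZ pE //; apply: I0.
  rewrite -linearB; apply: span_lin (ud i ir) => _ [j [k [Ijk jk ->]]]; rewrite pE //.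
  case: k jk {Ijk} => [|k] jk; last exact: span0.
  by apply: span_gen; exists j; case: jk.
have Ylm i j v : (i <= j)%N -> in_span (Yl i) v -> in_span (Yl j) v.
  by move=> ij; apply: span_mono => _ [k [ki ->]]; exists k; split=> //; apply: leq_trans ij.
(* [N] moves the leading term of [M i] onto the next end, so the diagonal entries accumulate in the
   leading coefficient. *)
have MY i : (i < r)%N -> in_span (Yl i) (M i - (\sum_(j < i.+1) d j) *: b i 0%N).
  elim: i => [|i IH] ir; first by rewrite big_ord1; apply: uY.
  have ir' := ltnW ir.
  have -> : M i.+1 - (\sum_(j < i.+2) d j) *: b i.+1 0%N =
      N (M i - (\sum_(j < i.+1) d j) *: b i 0%N) + (pY (u (b i.+1 0%N)) - d i.+1 *: b i.+1 0%N).
    by rewrite big_ord_recr (linearB N) (linearZZ N) NE ?ir /=; [lmod V|apply: I0].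
  apply: spanD; last exact: uY.
  apply: span_lin (IH ir') => _ [j [ji ->]].
  rewrite NE; last by apply/I0/(ltn_trans ji).
  by rewrite (leq_ltn_trans (leqW ji) ir); apply: span_gen; exists j.+1.
have JN i v : (i < r)%N -> in_span (Yl i) v -> J (N v) = v.
  move=> ir; apply: (@span_eq _ _ _ (J \o N) idfun) => _ [j [ji ->]] /=.
  rewrite NE; last by apply/I0/(ltn_trans ji).
  by rewrite (leq_ltn_trans ji ir) JE //; apply/I0/(leq_ltn_trans ji).
(* [N] loses only the last end. There the leading coefficient of [M i] is the full trace, which is
   zero. *)
have JNM i : (i < r)%N -> J (N (M i)) = M i.
  rewrite leq_eqVlt => /predU1P[ir|ir]; last first.
    apply: (JN i.+1 _ ir).
    rewrite -[M i](subrK ((\sum_(j < i.+1) d j) *: b i 0%N)); apply: spanD.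
      by apply: Ylm (MY i (ltnW ir)).
    by apply/spanZ/span_gen; exists i.
  have ir' : (i < r)%N by rewrite -ir.
  by apply: (JN i _ ir'); move: (MY i ir'); rewrite ir tr0 scale0r subr0.
apply: (@three_square_zero_of_chains _ _ _ I b u J R) => //.
- move=> i Ii; rewrite JE //; case: i Ii => [|i] [ir _]; first exact: span0.
  by apply: span_gen; exists i; split=> //; apply/I0/ltnW.
(* Values of [N] involve only ends of positive index, and those chains have length at least two;
   chain 0 may have length one. *)
- move=> i [ir _]; rewrite RE; last exact: I0.
  move: (M i) (MY i ir) => m.
  set y := _ *: _; rewrite -{2}[m](subrK y) => h; rewrite linearD; apply: spanD; last first.
    rewrite /y linearZZ; apply: spanZ; rewrite NE; last exact: I0.
    case: ifP => ir'; last exact: span0.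
    by apply: span_gen; exists i.+1; split=> //; split=> //; apply: l0.
  apply: span_lin h => _ [j [ji ->]]; have jr := leq_ltn_trans ji ir.
  rewrite NE; last by apply/I0/(ltn_trans ji).
  by rewrite jr; apply: span_gen; exists j.+1; split=> //; split=> //; apply: l0.
- move=> i [ir _]; rewrite RE ?JNM //.
  have -> : M i - R (J (b i 0%N)) = pY (u (b i 0%N)).
    case: i ir => [|i] ir; rewrite JE; try exact: I0; first by rewrite linear0 subr0.
    by rewrite RE /= ?[N _ + _]addrC ?addrK //; apply/I0/ltnW.
  have -> : u (b i 0%N) - pY (u (b i 0%N)) =
      (u (b i 0%N) - d i *: b i 0%N) - pY (u (b i 0%N) - d i *: b i 0%N).
    by rewrite (linearB pY) (linearZZ pY) (pE i); [lmod V|apply: I0].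
  move: (ud i ir); move: (_ - _); apply: span_ind => [|a v w hv hw|_ [j [[|k] [Ik _ ->]]]].
  + by rewrite linear0 subr0; exact: span0.
  + by rewrite linearP opprD addrACA -scalerBr; apply: spanP.
  + by rewrite pE // subrr; exact: span0.
  + by rewrite pE // subr0; apply: span_gen; exists j, k.
Qed.
End FiniteChains.

(** * Finite rank *)

Section KrylovChains.
Variables (F : fieldType) (V : lmodType F).
Implicit Types (B : V -> Prop).

Lemma infinite_dim_nspan (t : seq V) : infinite_dim V ->
  ~ forall x, in_span (fun v => v \in t) x.
Proof.
move=> /(_ (size t).+1)[s [ss us is_]] tV.
by have := steinitz us is_ (fun v _ => tV v); rewrite ss ltnn.
Qed.

Lemma lin_indep_finite (T : V -> Prop) (t : seq V) : lin_indep T ->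
  (forall x, T x -> in_span (fun v => v \in t) x) ->
  exists s : seq V, forall x, T x -> x \in s.
Proof.
move=> iT Tt; have [//|[f [fT fi]]] := finite_or_infset T; exfalso.
pose s := map f (iota 0 (size t).+1).
have sT v : v \in s -> T v by move=> /mapP[n _ ->]; apply: fT.
have us : uniq s by rewrite map_inj_uniq ?iota_uniq // => x y; apply: fi.
have := steinitz us (lin_indep_sub sT iT) (fun v vs => Tt v (sT v vs)).
by rewrite size_map size_iota ltnn.
Qed.

Variables (u w : {linear V -> V}) (lam : F).
Hypothesis uw : forall x, u x = lam *: x + w x.

Definition krylov (r : nat) (a : nat -> V) (l : nat -> nat) v :=
  exists i m, [/\ (i < r)%N, (m <= l i)%N & v = iter m u (a i)].

(** Each chain closes up modulo itself and the earlier ones, which makes the block on the ends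
    triangular. By the last clause, once the span contains the image of [w], it has a complement
    inside the kernel of [w]. *)
Definition krylov_system r a l :=
  [/\ forall i m i' m', (i < r)%N -> (m <= l i)%N -> (i' < r)%N -> (m' <= l i')%N ->
        iter m u (a i) = iter m' u (a i') -> i = i' /\ m = m',
      lin_indep (krylov r a l),
      forall i, (i < r)%N -> in_span (krylov i.+1 a l) (iter (l i).+1 u (a i)),
      forall i, (i < r)%N -> (0 < l i)%N
    & forall z, in_span (krylov r a l) z -> (exists x, z = w x) ->
        exists2 y, in_span (krylov r a l) y & z = w y].

Lemma krylov_finite r a l : exists s : seq V, forall v, krylov r a l v -> v \in s.
Proof.
exists (flatten [seq [seq iter m u (a i) | m <- iota 0 (l i).+1] | i <- iota 0 r]).
move=> _ [i [m [ir ml ->]]]; apply/flatten_mapP; exists i; first by rewrite mem_iota.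
by apply/mapP; exists m; rewrite // mem_iota.
Qed.

(** Adding to [x0] a kernel vector [f] in general position does not change [w x0], and puts [x]
    outside the sum of the old span and the image of [w]. This forces the chain of [x] to have
    length at least two and preserves the last clause of [krylov_system]. *)
Lemma krylov_system_step r a l x0 (s : seq V) : krylov_system r a l ->
  (forall x, in_span (fun v => v \in s) (w x)) ->
  (forall t : seq V, exists f, w f = 0 /\ ~ in_span (fun v => v \in t) f) ->
  ~ in_span (krylov r a l) (w x0) ->
  exists a' l', [/\ krylov_system r.+1 a' l',
    forall v, krylov r a l v -> krylov r.+1 a' l' v & in_span (krylov r.+1 a' l') (w x0)].
Proof.
move=> [inj iB cl l0 wB] ws kerw ny; set B := krylov r a l in iB wB ny *.
have [LB LBE] := krylov_finite r a l.
have [f [wf nf]] := kerw (LB ++ x0 :: s).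
pose x := x0 + f; have wx : w x = w x0 by rewrite linearD wf addr0.
have xB al z q : in_span B z -> al *: x = z + w q -> al = 0.
  move=> Bz e; apply: contrapT => /eqP al0; apply: nf.
  have -> : f = al^-1 *: (z + w q) - x0 by rewrite -e scalerK // /x; lmod V.
  have mono (t : seq V) y : {subset t <= LB ++ x0 :: s} -> in_span (fun v => v \in t) y ->
      in_span (fun v => v \in LB ++ x0 :: s) y by move=> h; apply: span_mono => v /h.
  apply: spanB; last by apply: span_gen; rewrite mem_cat mem_head orbT.
  apply/spanZ/spanD.
    by apply: span_mono Bz => v /LBE vL; rewrite mem_cat vL.
  by apply: mono (ws q) => v vs; rewrite mem_cat inE vs !orbT.
pose e m := iter m u x.
have eS m : e m.+1 = lam *: e m + w (e m) by rewrite -uw.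
pose C k v := B v \/ exists m, (m < k)%N /\ v = e m.
have CS k v : C k.+1 v <-> C k v \/ v = e k.
  split=> [[Bv|[m [mk ->]]]|[[Bv|[m [mk ->]]]|->]].
  - by left; left.
  - move: mk; rewrite ltnS leq_eqVlt => /predU1P[->|mk]; first by right.
    by left; right; exists m.
  - by left.
  - by right; exists m; split=> //; apply: ltnW.
  - by right; exists k.
have iC k : (forall m, (m < k)%N -> ~ in_span (C m) (e m)) -> lin_indep (C k).
  elim: k => [|k IH] h; first by apply: lin_indep_sub iB => v [//|[m []]].
  apply: (@lin_indep_sub _ _ _ (fun v => C k v \/ v = e k)) => [v /CS//|].
  by apply: lin_indep_add; [apply: IH => m /ltnW; apply: h|apply: h].
have neqe k m m' : (forall m, (m < k)%N -> ~ in_span (C m) (e m)) ->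
    (m' < k)%N -> (m < m')%N -> e m <> e m'.
  by move=> h m'k mm' ee; apply: (h m' m'k); apply: span_gen; right; exists m.
(* The chain must stop, since all iterates of [x] lie in the span of [x] and the finite-dimensional
   image of [w]. *)
have [k kP] : exists k, `[< in_span (C k) (e k) >].
  apply: contrapT => nk; have h k : ~ in_span (C k) (e k).
    by move=> ek; apply: nk; exists k; apply/asboolP.
  pose t := map e (iota 0 (size s).+2).
  have ut : uniq t.
    rewrite map_inj_uniq ?iota_uniq // => m m' ee.
    have [mm'|mm'|//] := ltngtP m m'.
      by case: (neqe m'.+1 m m' (fun i _ => h i) (ltnSn _) mm' ee).
    by case: (neqe m.+1 m' m (fun i _ => h i) (ltnSn _) mm' (esym ee)).
  have it : lin_indep (fun v => v \in t).
    apply: lin_indep_sub (iC (size s).+2 (fun m _ => h m)) => v /mapP[m].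
    by rewrite mem_iota => /= mk ->; right; exists m.
  have : (size t <= size (x :: s))%N.
    apply: steinitz => // v /mapP[m _ ->]; elim: m => [|m IH].
      by apply: span_gen; rewrite mem_head.
    rewrite eS; apply: spanD; first exact: spanZ.
    by apply: span_mono (ws (e m)) => y ys; rewrite inE ys orbT.
  by rewrite size_map size_iota /= ltnn.
have [{kP}k /asboolP kP kmin] := ex_minnP (ex_intro (fun k => is_true `[< in_span (C k) (e k) >]) k kP).
have kN m : (m < k)%N -> ~ in_span (C m) (e m).
  by move=> mk /asboolP /kmin; rewrite leqNgt mk.
(* If [u x] were [al *: x] modulo the old span, general position would give [al = lam], and [w x0]
   would lie in the old span. *)
have k1 : (1 < k)%N.
  case: k kP {kmin kN} => [|[|//]] /= h; exfalso.
    have Bx : in_span B x by apply: span_mono h => v [//|[m []]].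
    have := xB 1 x 0 Bx; rewrite linear0 addr0 scale1r => /(_ erefl)/eqP.
    by rewrite oner_eq0.
  have : in_span (fun v => B v \/ v = x) (e 1%N).
    by apply: span_mono h => v [Bv|[[|m] []// _ ->]]; [left|right].
  move=> /span_or[al]; rewrite eS /= => h1.
  have al0 : al - lam = 0.
    apply: (xB _ (- (lam *: x + w x - al *: x)) x); first exact: spanN.
    by lmod V.
  apply: ny; rewrite -wx; move: h1; move/eqP: al0; rewrite subr_eq0 => /eqP ->.
  by rewrite addrAC subrr add0r.
pose a' i := if i == r then x else a i.
pose l' i := if i == r then k.-1 else l i.
have a'E i : (i < r)%N -> a' i = a i by rewrite /a'; case: eqP => // ->; rewrite ltnn.
have l'E i : (i < r)%N -> l' i = l i by rewrite /l'; case: eqP => // ->; rewrite ltnn.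
have kE : k.-1.+1 = k by rewrite prednK // ltnW.
have KE i : (i <= r)%N -> krylov i a' l' = krylov i a l.
  move=> ir; apply/funext => v; apply/propext.
  by split=> -[j [m [ji mj ->]]]; exists j, m; have jr := leq_trans ji ir;
    rewrite a'E ?l'E // in mj *.
have CE : krylov r.+1 a' l' = C k.
  apply/funext => v; apply/propext; split.
    move=> [i [m []]]; rewrite ltnS leq_eqVlt => /predU1P[->|ir].
      by rewrite /a' /l' eqxx -[(_ <= k.-1)%N]ltnS kE => mk ->; right; exists m.
    by rewrite a'E // l'E // => mi ->; left; exists i, m.
  move=> [[i [m [ir mi ->]]]|[m [mk ->]]].
    by exists i, m; rewrite a'E // l'E //; split=> //; apply: ltnW.
  by exists r, m; rewrite /a' /l' eqxx -[(_ <= k.-1)%N]ltnS kE.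
exists a', l'; rewrite CE; split; last 2 first.
- by move=> v Bv; left.
- have -> : w x0 = e 1%N - lam *: e 0%N by rewrite eS wx; lmod V.
  by apply: spanB; [|apply: spanZ]; apply: span_gen; right;
    [exists 1%N|exists 0%N; split=> //; apply: ltnW].
split.
- have eB i m m' : (i < r)%N -> (m <= l i)%N -> (m' < k)%N -> iter m u (a i) <> e m'.
    move=> ir mi m'k ee; apply: (kN m' m'k); apply: span_gen; left.
    by exists i, m.
  have cs j : (j < r.+1)%N -> j = r \/ (j < r)%N by rewrite ltnS leq_eqVlt => /predU1P.
  have rE : (a' r = x) * (forall m, (m <= l' r)%N = (m < k)%N).
    by rewrite /a' /l' eqxx; split=> // m; rewrite -ltnS kE.
  move=> i m i' m' /cs[->|ir] mi /cs[->|ir'] mi'; move: mi mi'; rewrite ?rE;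
    do 2?[rewrite a'E; last by []]; do 2?[rewrite l'E; last by []].
  + move=> mk m'k ee; split=> //; have [mm'|mm'|//] := ltngtP m m'.
      by case: (neqe k m m' kN m'k mm' ee).
    by case: (neqe k m' m kN mk mm' (esym ee)).
  + by move=> mk mi /esym /(eB _ _ _ ir' mi mk).
  + by move=> mi mk /(eB _ _ _ ir mi mk).
  + by move=> mi mi' ee; apply: inj.
- by rewrite CE; apply: iC.
- move=> i; rewrite ltnS leq_eqVlt => /predU1P[->|ir].
    by rewrite CE /a' /l' eqxx kE.
  by rewrite KE // a'E // l'E //; apply: cl.
- move=> i; rewrite ltnS leq_eqVlt => /predU1P[->|ir]; last by rewrite l'E //; apply: l0.
  by rewrite /l' eqxx -[(_ <= k.-1)%N]ltnS kE.
(* Because [u = lam + w], an element of the new span is an old one plus a multiple of [x] plus [w]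
   of a new one; if it lies in the image of [w], the multiple of [x] vanishes. *)
- rewrite CE; have dec v : in_span (C k) v ->
      exists b al q, [/\ in_span B b, in_span (C k) q & v = b + al *: x + w q].
    move: v; apply: span_ind => [|c v v' [b [al [q [Bb Cq ->]]]] [b' [al' [q' [Bb' Cq' ->]]]]|v].
    - by exists 0, 0, 0; split; [apply: span0|apply: span0|rewrite linear0; lmod V].
    - exists (c *: b + b'), (c * al + al'), (c *: q + q'); split; try exact: spanP.
      by rewrite linearP; lmod V.
    - move=> [Bv|[m [mk ->]]].
        exists v, 0, 0; split; [exact: span_gen|exact: span0|rewrite linear0; lmod V].
      elim: m mk => [|m IH] mk.
        exists 0, 1, 0; split; [exact: span0|exact: span0|rewrite linear0 /e /=; lmod V].
      have [b [al [q [Bb Cq eq]]]] := IH (ltnW mk).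
      exists (lam *: b), (lam * al), (lam *: q + e m); split; first exact: spanZ.
        by apply: spanP => //; apply: span_gen; right; exists m; split=> //; apply: ltnW.
      by rewrite eS linearP {1}eq; lmod V.
  move=> z /dec[b [al [q [Bb Cq ->]]]] [y ey].
  have al0 : al = 0.
    apply: (xB al (- b) (y - q)); first exact: spanN.
    by rewrite linearB -ey; lmod V.
  rewrite {}al0 in ey *.
  have [|p Bp bp] := wB b Bb.
    by exists (y - q); rewrite linearB -ey; lmod V.
  exists (p + q); last by rewrite {1}bp (linearD w); lmod V.
  by apply: spanD => //; apply: span_mono Bp => v Bv; left.
Qed.

Lemma krylov_system_exists (s : seq V) :
  (forall x, in_span (fun v => v \in s) (w x)) -> (forall y, y \in s -> exists x, y = w x) ->
  (forall t : seq V, exists f, w f = 0 /\ ~ in_span (fun v => v \in t) f) ->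
  exists r a l, krylov_system r a l /\ forall x, in_span (krylov r a l) (w x).
Proof.
move=> ws sw kerw.
suff [r [a [l [sys h]]]] : exists r a l, krylov_system r a l /\
    forall v, v \in s -> in_span (krylov r a l) v.
  by exists r, a, l; split=> // x; apply: span_sub (ws x).
have: forall y, y \in s -> exists x, y = w x by [].
elim: {1 2}s => [|y t IH] tw.
  exists 0%N, (fun=> 0), (fun=> 0%N); split=> //; split=> //.
    by apply: lin_indep_sub (@lin_indep0 F V) => v [i [m []]].
  move=> z h _; exists 0; first exact: span0; rewrite linear0; move: z h.
  by apply: span_ind => [//|c x z -> ->|v [i [m []]]//]; rewrite scaler0 addr0.
have [|r [a [l [sys h]]]] := IH; first by move=> z zt; apply: tw; rewrite inE zt orbT.
have [x yx] := tw y (mem_head _ _).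
have [By|nBy] := pselect (in_span (krylov r a l) y).
  by exists r, a, l; split=> // v; rewrite inE => /predU1P[->|/h].
rewrite yx in nBy; have [a' [l' [sys' sub By]]] := krylov_system_step sys ws kerw nBy.
exists r.+1, a', l'; split=> // v; rewrite inE => /predU1P[->|/h]; first by rewrite yx.
exact: span_mono.
Qed.
End KrylovChains.

(** * Trace of the end block and the finite-rank case *)

Section FiniteRank.
Variables (F : fieldType) (V : lmodType F).

Lemma span_coord (T : finType) (e : T -> V) (L : T -> {linear V -> F^o}) :
  (forall x y, L y (e x) = (x == y)%:R) ->
  forall v, in_span (fun v => exists x, v = e x) v -> v = \sum_x L x v *: e x.
Proof.
move=> LE; apply: span_ind => [|c x y hx hy|_ [x ->]].
- by rewrite big1 // => x _; rewrite linear0 scale0r.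
- rewrite {1}hx {1}hy scaler_sumr -big_split; apply: eq_bigr => z _ /=.
  by rewrite linearP scalerDl scalerA.
- by rewrite (bigD1 x) //= LE eqxx scale1r big1 ?addr0 // => y /negbTE yx;
    rewrite LE eq_sym yx scale0r.
Qed.

(** The dual family [L] supplies both the independence of [e] and the matrix entries, for a basis
    indexed by any finite type. *)
Lemma is_trace_fin (T : finType) (e : T -> V) (L : T -> {linear V -> F^o}) (f : {linear V -> V}) :
  (forall x y, L y (e x) = (x == y)%:R) ->
  (forall v, in_span (fun v => exists x, v = e x) (f v)) ->
  is_trace f (\sum_x L x (f (e x))).
Proof.
move=> LE fe.
have sumE (U : nmodType) (g : T -> U) : \sum_(i < #|T|) g (enum_val i) = \sum_x g x.
  by rewrite [RHS](reindex _ (onW_bij _ (enum_val_bij T))).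
exists #|T|, (fun i => e (enum_val i)), (fun i j => L (enum_val j) (f (e (enum_val i)))).
split=> [c c0 i|x|i|].
- have : L (enum_val i) (\sum_i c i *: e (enum_val i)) = 0 by rewrite c0 linear0.
  rewrite linear_sum (bigD1 i) //= linearZ /= LE eqxx [c i *: 1]mulr1 big1 ?addr0 // => j ij.
  by rewrite linearZ /= LE (inj_eq enum_val_inj) (negbTE ij) [_ *: _]mulr0.
- exists (fun i => L (enum_val i) (f x)).
  by rewrite (sumE _ (fun y => L y (f x) *: e y)); apply: (span_coord LE).
- by rewrite (sumE _ (fun y => L y (f (e (enum_val i))) *: e y)); apply: (span_coord LE).
- by rewrite (sumE _ (fun y => L y (f (e y)))).
Qed.

Lemma natmul_double0 (lam : F) n : lam + lam = 0 -> lam *+ n = 0 \/ lam *+ n = lam.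
Proof.
move=> lam2; elim: n => [|n [IH|IH]]; first by left.
  by right; rewrite mulrS IH addr0.
by left; rewrite mulrS IH.
Qed.

Variables (u w : {linear V -> V}) (lam : F).
Hypothesis uw : forall x, u x = lam *: x + w x.

(** In the basis of the chains, [u] shifts every vector except the ends, so its diagonal consists of
    the [d i] and zeros. Passing from [u] to [w] subtracts [lam] once for each of the [n] basis
    vectors. *)
Lemma krylov_trace r a l : krylov_system u w r a l ->
  (forall x, in_span (krylov u r a l) (w x)) ->
  exists d : nat -> F,
    (forall i, (i < r)%N -> in_span (fun v => exists j k,
       [/\ (j < r)%N /\ (k <= l j)%N, (j < i)%N \/ (0 < k)%N & v = iter (l j - k) u (a j)])
     (u (iter (l i) u (a i)) - d i *: iter (l i) u (a i))) /\
    exists n, is_trace w (\sum_(i < r) d i - lam *+ n).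
Proof.
move=> [inj iB cl _ _] ww.
pose I i k := (i < r)%N /\ (k <= l i)%N.
(* Chains are numbered backwards: [u] lowers [k], and the end [b i 0] is the last iterate. *)
pose b i k := iter (l i - k) u (a i).
have /choice[d dP] : forall i, exists d, (i < r)%N -> in_span (fun v => exists j k,
       [/\ (j < r)%N /\ (k <= l j)%N, (j < i)%N \/ (0 < k)%N & v = b j k])
     (u (iter (l i) u (a i)) - d *: iter (l i) u (a i)).
  move=> i; have [ir|] := boolP (i < r)%N; last by exists 0.
  suff [d h] : exists d, in_span (fun v => exists j k,
       [/\ (j < r)%N /\ (k <= l j)%N, (j < i)%N \/ (0 < k)%N & v = b j k])
     (u (iter (l i) u (a i)) - d *: iter (l i) u (a i)) by exists d.
  move: (cl i ir); rewrite iterS; move: (u _); apply: span_ind.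
  - by exists 0; rewrite scale0r subrr; exact: span0.
  - move=> c x y [d hx] [d' hy]; exists (c * d + d').
    by rewrite scalerDl -scalerA opprD addrACA -scalerBr; apply: spanP.
  - move=> _ [j [m [ji mj ->]]]; have jr : (j < r)%N by apply: leq_ltn_trans ir; rewrite -ltnS.
    have [[-> ->]|jmi] := eqVneq (j, m) (i, l i).
      by exists 1; rewrite scale1r subrr; exact: span0.
    exists 0; rewrite scale0r subr0; apply: span_gen; exists j, (l j - m)%N.
    rewrite leq_subr /b subKn //; split=> //.
    move: ji mj jr jmi; rewrite ltnS leq_eqVlt => /predU1P[->|ji] mj jr; last by left.
    by rewrite xpair_eqE eqxx => ml; right; rewrite subn_gt0 ltn_neqAle ml mj.
exists d; split=> //.
pose T : finType := {i : 'I_r & 'I_(l i).+1}.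
pose e (x : T) := b (tag x) (tagged x).
have eT i k : I i k -> exists x : T, [/\ tag x = i :> nat, tagged x = k :> nat & e x = b i k].
  move=> [ir kl]; have kl' : (k < (l (Ordinal ir)).+1)%N by [].
  by exists (Tagged (fun i : 'I_r => 'I_(l i).+1) (Ordinal kl')).
have einj x y : e x = e y -> x = y.
  case: x y => [i k] [j m]; rewrite /e /b /= => eq.
  have ki : (k <= l i)%N by rewrite -ltnS. have mj : (m <= l j)%N by rewrite -ltnS.
  have [ij] := inj _ _ _ _ (ltn_ord i) (leq_subr _ _) (ltn_ord j) (leq_subr _ _) eq.
  move: (val_inj ij) => {}ij; subst j => km.
  have -> // : k = m; apply: val_inj => /=.
  by rewrite -(subKn ki) -(subKn mj) km.
have eB v : krylov u r a l v <-> exists x, v = e x.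
  split=> [[i [m [ir ml ->]]]|[[i k] ->]].
    have [|x [_ _ ex]] := eT i (l i - m)%N; first by split=> //; exact: leq_subr.
    by exists x; rewrite ex /b subKn.
  by exists i, (l i - k)%N; split=> //; exact: leq_subr.
have extL x : exists L : {linear V -> F^o}, forall y, L (e y) = (y == x)%:R.
  have [||L LE] := @lin_ext_fam _ _ F^o T (fun _ => True) e (fun y => (y == x)%:R).
  - by move=> y z _ _; apply: einj.
  - by apply: lin_indep_sub iB => v [y [_ ->]]; apply/eB; exists y.
  - by exists L => y; apply: LE.
have /choice[L LE] := extL.
have spanE : in_span (krylov u r a l) = in_span (fun v => exists x, v = e x).
  by congr in_span; apply/funext => v; apply/propext; apply: eB.
exists #|T|; have -> : \sum_(i < r) d i - lam *+ #|T| = \sum_x L x (w (e x)); last first.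
  by apply: is_trace_fin => [x y|v]; [apply: LE|rewrite -spanE].
have wE x : w (e x) = u (e x) - lam *: e x by rewrite uw; lmod V.
under [RHS]eq_bigr => x _ do rewrite wE linearB linearZ /= LE eqxx [lam *: 1]mulr1.
rewrite sumrB sumr_const -[#|xpredT|]/#|T|; congr (_ - _).
have diag (i : 'I_r) (k : 'I_(l i).+1) (x : T) :
    x = Tagged (fun i : 'I_r => 'I_(l i).+1) k -> L x (u (e x)) = if k == ord0 then d i else 0.
  move=> xT; have Lb j m : I j m -> (j, m) != (i : nat, k : nat) -> L x (b j m) = 0.
    move=> /eT[y [<- <- <-]] yx; rewrite LE; case: eqP => // yE.
    by rewrite yE xT eqxx in yx.
  have [k0|k0] := eqVneq k ord0.
    have xE : e x = iter (l i) u (a i) by rewrite xT /e /b /= k0 subn0.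
    have Lx : L x (e x) = 1 by rewrite LE eqxx.
    rewrite xE in Lx *; set y := iter _ _ _ in Lx *.
    rewrite -[u y](subrK (d i *: y)) (linearD (L x)) (linearZZ (L x)) Lx [_ *: 1]mulr1.
    suff -> : L x (u y - d i *: y) = 0 by rewrite add0r.
    apply: (@span_eq _ _ _ (L x) \0 _ _ _ (dP i (ltn_ord i))) => _ [j [m [jm ji ->]]].
    apply: Lb => //; rewrite xpair_eqE negb_and k0 /=; case: ji => [ji|m0].
      by rewrite (ltn_eqF ji).
    by rewrite -lt0n m0 orbT.
  have kl : (k <= l i)%N by rewrite -ltnS.
  have k1 : (0 < k)%N by rewrite lt0n.
  have -> : u (e x) = b i k.-1.
    by rewrite xT /e /b /= -iterS -subSn // -subSS -{1}(prednK k1) !subSS.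
  apply: Lb; first by split=> //; rewrite (leq_trans _ kl) ?leq_pred.
  by rewrite xpair_eqE eqxx /= ltn_eqF // prednK.
rewrite [RHS](eq_bigr (fun x : T => if tagged x == ord0 then d (tag x) else 0)); last first.
  by move=> [i k] _; apply: (diag i k).
rewrite -(sig_big_dep xpredT (fun=> xpredT)
  (fun (i : 'I_r) (k : 'I_(l i).+1) => if k == ord0 then d i else 0)) /=.
apply: eq_bigr => i _; rewrite big_ord_recl eqxx big1 ?addr0 // => k _.
Qed.

(** The span of the Krylov chains is [u]-stable and has an infinite complement in the kernel of [w],
    where [u] is scalar. As [lam + lam = 0], the condition on [tr w] leaves [0] and [lam] for the
    sum of the [d i]. *)
Lemma three_square_zero_finite_rank : infinite_dim V -> finite_rank w -> lam + lam = 0 ->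
  (forall t, is_trace w t -> t = 0 \/ t = lam) ->
  exists a b c : {linear V -> V},
    [/\ square_zero a, square_zero b, square_zero c & forall x, u x = a x + b x + c x].
Proof.
move=> infV [s0 ws0] lam2 trw.
pose R v := exists x, v = w x.
have [s [sw ws]] : exists s : seq V, (forall y, y \in s -> R y) /\
    forall x, in_span (fun v => v \in s) (w x).
  have [T [TR _ iT RT]] := @basis_ext _ _ _ R (@lin_indep0 F V).
  have [||t0 Tt0] := @lin_indep_finite _ _ T s0.
  - by apply: lin_indep_sub iT => v; right.
  - by move=> v /TR[x ->].
  exists [seq v <- t0 | `[< T v >]]; split=> [y|x].
    by rewrite mem_filter => /andP[/asboolP/TR].
  have wR : R (w x) by exists x.
  by apply: span_mono (RT _ wR) => v [//|Tv]; rewrite mem_filter Tt0 // andbT; apply/asboolP.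
(* A kernel contained in a finite span, together with preimages [xs] of the finite generators of the
   image, would span [V]. *)
have kerw (t : seq V) : exists f, w f = 0 /\ ~ in_span (fun v => v \in t) f.
  apply: contrapT => h; have kt f : w f = 0 -> in_span (fun v => v \in t) f.
    by move=> wf; apply: contrapT => nf; apply: h; exists f.
  have [xs xsP] : exists xs : seq V, forall y, in_span (fun v => v \in s) y ->
      exists2 x, in_span (fun v => v \in xs) x & w x = y.
    elim: s sw {ws} => [|y s IH] sw.
      exists [::] => y ys; exists 0; first exact: span0; rewrite linear0.
      by move: y ys; apply: span_ind => // c x y <- <-; rewrite scaler0 addr0.
    have [|xs xsP] := IH; first by move=> z zs; apply: sw; rewrite inE zs orbT.
    have [x yx] := sw y (mem_head _ _); exists (x :: xs) => z zs.
    have [al /xsP[q qs wq]] : exists al, in_span (fun v => v \in s) (z - al *: y).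
      by apply: span_or; apply: span_mono zs => v; rewrite inE => /predU1P[->|]; [right|left].
    exists (al *: x + q); last by rewrite linearP wq yx; lmod V.
    apply: spanP; first by apply: span_gen; rewrite mem_head.
    by apply: span_mono qs => v vs; rewrite inE vs orbT.
  apply: (@infinite_dim_nspan _ _ (t ++ xs) infV) => x.
  have [q qs wq] := xsP _ (ws x); rewrite -[x](subrK q); apply: spanD.
    have /kt : w (x - q) = 0 by rewrite linearB wq subrr.
    by apply: span_mono => v vs; rewrite mem_cat vs.
  by apply: span_mono qs => v vs; rewrite mem_cat vs orbT.
have [r [a [l [sys wB]]]] := krylov_system_exists uw ws sw kerw.
have [d [dP [n trd]]] := krylov_trace sys wB.
case: (sys) => inj iB cl l0 wwB; set B := krylov u r a l in iB wB wwB.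
have [T [Tker TB iBT sT]] := @basis_ext _ _ B (fun x => w x = 0) iB.
have BT x : in_span (fun v => B v \/ T v) x.
  have [|y By wxy] := wwB (w x) (wB x); first by exists x.
  rewrite -[x](subrK y); apply: spanD; last by apply: span_mono By => v; left.
  by apply: sT; rewrite linearB wxy subrr.
have infT (S : V -> Prop) (t : seq V) : (forall x, T x -> S x \/ x \in t) -> infset S.
  move=> TS; have [[t' St']|//] := finite_or_infset S; exfalso.
  have [LB LBE] := krylov_finite u r a l.
  apply: (@infinite_dim_nspan _ _ (LB ++ t' ++ t) infV) => x.
  apply: span_mono (BT x) => v [/LBE|/TS[/St'|]] h; rewrite !mem_cat h ?orbT //.
have uT v : T v -> u v = lam *: v by move=> /Tker wv; rewrite uw wv addr0.
pose I i k := (i < r)%N /\ (k <= l i)%N.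
pose b i k := iter (l i - k) u (a i).
have BE : B = (fun v => exists i k, I i k /\ v = b i k).
  apply/funext => v; apply/propext; split=> [[i [m [ir ml ->]]]|[i [k [[ir kl] ->]]]].
    by exists i, (l i - m)%N; rewrite /b subKn //; split=> //; split=> //; apply: leq_subr.
  by exists i, (l i - k)%N; split=> //; apply: leq_subr.
have binj i k i' k' : I i k -> I i' k' -> b i k = b i' k' -> i = i' /\ k = k'.
  move=> [ir kl] [ir' kl'] /inj h; have [||||ii kk] := h; rewrite ?leq_subr //.
  by split=> //; rewrite -(subKn kl) -(subKn kl') kk ii.
have bS i k : I i k.+1 -> u (b i k.+1) = b i k.
  by move=> [ir kl]; rewrite /b -iterS -subSn // subSS.
have [tr0|trl] : \sum_(i < r) d i = 0 \/ \sum_(i < r) d i = lam.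
  have [n0|nl] := natmul_double0 n lam2; move: (trw _ trd); rewrite ?n0 ?nl ?subr0 //.
  move=> [/eqP|/eqP]; rewrite subr_eq; last rewrite lam2; move=> /eqP->; rewrite ?add0r; by [right|left].
- apply: (three_square_zero_glue iBT) => //.
  + by move=> v Bv Tv; apply: (TB v).
  + rewrite BE; apply: (@three_square_zero_finite _ _ r l b u d) => //.
    * by rewrite -/I -BE.
    * by move=> i /andP[_]; apply: l0.
    * by move=> i ir; rewrite /b subn0; apply: dP.
  + apply: (three_square_zero_scalar _ uT) => //; first by apply: lin_indep_sub iBT; right.
    by right; apply: (infT T [::]); left.
(* the block of size 1 on an eigenvector [f] corrects the trace *)
have [f Tf] : exists f, T f.
  by have [f [fT _]] := infT T [::] (fun x Tx => or_introl Tx); exists (f 0%N); apply: fT.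
pose B' v := B v \/ v = f; pose T' v := T v /\ v <> f.
have BTE : (fun v => B v \/ T v) = (fun v => B' v \/ T' v).
  apply/funext => v; apply/propext; split=> [[Bv|Tv]|[[Bv|->]|[Tv _]]]; try by [left|right].
    by left; left.
  by have [->|vf] := pselect (v = f); [left; right|right].
rewrite BTE in iBT BT.
(* [f] becomes chain 0, the only place where length one is allowed; its entry [lam] brings the trace
   to [lam + lam = 0]. *)
pose l' i := if i is j.+1 then l j else 0%N.
pose b' i k := if i is j.+1 then b j k else f.
pose d' i := if i is j.+1 then d j else lam.
have nbf i k : I i k -> b i k <> f.
  by move=> Ik bf; apply: (TB f Tf); rewrite BE; exists i, k.
have BE' : B' = (fun v => exists i k, ((i < r.+1)%N /\ (k <= l' i)%N) /\ v = b' i k).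
  apply/funext => v; apply/propext; rewrite /B' BE; split.
    by move=> [[i [k [Ik ->]]]|->]; [exists i.+1, k|exists 0%N, 0%N].
  by move=> [[|i] [k [Ik ->]]]; [right|left; exists i, k].
apply: (three_square_zero_glue iBT) => //.
- by move=> v [Bv|->] [Tv] //; [move=> _; apply: (TB v)].
- have iB' : lin_indep B' by apply: lin_indep_sub iBT; left.
  rewrite BE'; apply: (@three_square_zero_finite _ _ r.+1 l' b' u d').
  + move=> [|i] k [|i'] k' [ir kl] [ir' kl'] /=.
    * by move: kl kl'; rewrite /= !leqn0 => /eqP-> /eqP->.
    * by move=> /esym /nbf; case.
    * by move=> /nbf; case.
    * by move=> /binj[] // -> ->.
  + by rewrite -BE'.
  + by move=> [//|i] /andP[_]; apply: l0.
  + by move=> [|i] k [ir kl] //; apply: bS.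
  + move=> [|i] ir.
      by rewrite /= uT // subrr; apply: span0.
    rewrite /= /b subn0; apply: span_mono (dP i ir) => _ [j [k [[jr kl] h ->]]].
    by exists j.+1, k.
  + by rewrite big_ord_recl /= trl.
- apply: (three_square_zero_scalar _ (u := u) (lam := lam)) => //.
  + by apply: lin_indep_sub iBT; right.
  + by move=> v [Tv _]; apply: uT.
  + right; apply: (infT T' [:: f]) => x Tx.
    by have [->|xf] := pselect (x = f); [right; rewrite inE|left].
Qed.
End FiniteRank.

(** * Necessity *)

(** In a full-rank factorisation [A = C R], the outer factors of [C R C R = 0] cancel, so [R C = 0],
    and [R C] has the same trace as [A]. *)
Lemma mxtrace_square_zero (F : fieldType) n (A : 'M[F]_n) : A *m A = 0 -> \tr A = 0.
Proof.
move: (col_base A) (row_base A) (col_base_full A) (row_base_free A) (mulmx_base A).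
move=> C R Cfull Rfree <- CR0; rewrite mxtrace_mulC.
suff -> : R *m C = 0 by rewrite mxtrace0.
have [C' CC] : exists C', C' *m C = 1%:M by exists (pinvmx C); apply: mulVpmx.
have [R' RR] : exists R', R *m R' = 1%:M by exists (pinvmx R); apply: mulmxVp.
have <- : C' *m (C *m R *m (C *m R)) *m R' = R *m C.
  by rewrite !mulmxA CC mul1mx -[R *m C *m R *m R']mulmxA RR mulmx1.
by rewrite CR0 mulmx0 mul0mx.
Qed.

Section Necessity.
Variables (F : fieldType) (V : lmodType F).

Lemma square_zero_trace N (e : 'I_N -> V) (L : 'I_N -> {linear V -> F^o}) (a : {linear V -> V}) :
  (forall i j, L j (e i) = (i == j)%:R) ->
  (forall i, in_span (fun v => exists i, v = e i) (a (e i))) -> square_zero a ->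
  \sum_i L i (a (e i)) = 0.
Proof.
move=> LE ae aa; pose A := \matrix_(i, j) (L j (a (e i)) : F).
transitivity (\tr A); first by apply: eq_bigr => i _; rewrite mxE.
apply: mxtrace_square_zero; apply/matrixP => i k; rewrite !mxE.
transitivity (L k (a (a (e i)))); last by rewrite aa linear0.
rewrite (span_coord LE (ae i)) !linear_sum; apply: eq_bigr => j _.
by rewrite !mxE !linearZ.
Qed.

Variables (a b c w : {linear V -> V}) (lam : F).
Hypotheses (aa : square_zero a) (bb : square_zero b) (cc : square_zero c).
Hypothesis abc : forall x, lam *: x + w x = a x + b x + c x.

Let cE x : c x = lam *: x + w x - a x - b x.
Proof. by rewrite abc; lmod V. Qed.

(** Both sides compute [(a + b)^2], the right one from [a + b = lam + w - c] and [c^2 = 0]. Each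
    term of the last group contains a factor [w]. *)
Lemma three_square_zero_anticomm x :
  a (b x) + b (a x) = lam ^+ 2 *: x - (lam + lam) *: c x + (lam *: w x + w (a x + b x) - c (w x)).
Proof.
have := cc x; rewrite [X in c X]cE !(linearB c) (linearD c) (linearZZ c) => ccx.
have E z : a z + b z = lam *: z + w z - c z by rewrite cE; lmod V.
have -> : a (b x) + b (a x) = a (a x + b x) + b (a x + b x).
  by rewrite !linearD aa bb; lmod V.
have -> : lam *: w x + w (a x + b x) - c (w x) =
   lam *: w x + w (a x + b x) - c (w x) +
   (lam *: c x + c (w x) - c (a x) - c (b x)) by rewrite ccx addr0.
by rewrite E (linearD c) [c x]cE; lmod V.
Qed.

(** Words of length at most two in [a] and [b] applied to [e] span a stable space: with
    [lam + lam = 0], the map [a b + b a] is [lam^2] up to a map into [G3], and [a b a] is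
    [a b + b a] applied after [a]. On this space the traces of [a], [b], [c] vanish, so [tr w] is
    minus the dimension times [lam], that is [0] or [lam]. *)
Lemma trace_sum_three_square_zero t : lam + lam = 0 -> is_trace w t -> t = 0 \/ t = lam.
Proof.
move=> lam2 [n [e [A [efree we eA ->]]]].
pose E v := exists i, v = e i.
pose G v := E v \/ exists i, [\/ v = a (e i), v = b (e i), v = a (b (e i)) | v = b (a (e i))].
have wE x : in_span E (w x).
  have [d ->] := we x; apply: span_sum => i _; apply/spanZ/span_gen; by exists i.
pose G3 v := E v \/ exists i, v = a (e i) \/ v = b (e i).
have G3G v : in_span G3 v -> in_span G v.
  apply: span_mono => x [|[i [->|->]]]; first by left.
    by right; exists i; constructor 1.
  by right; exists i; constructor 2.
have EG3 v : in_span E v -> in_span G3 v by apply: span_mono; left.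
have gen3 (f : {linear V -> V}) : (forall i, in_span G3 (f (e i))) ->
    forall v, in_span E v -> in_span G3 (f v).
  by move=> fe; apply: span_lin => _ [i ->].
have aE v : in_span E v -> in_span G3 (a v).
  by apply: gen3 => i; apply: span_gen; right; exists i; left.
have bE v : in_span E v -> in_span G3 (b v).
  by apply: gen3 => i; apply: span_gen; right; exists i; right.
have cG3 v : in_span E v -> in_span G3 (c v).
  move=> Ev; rewrite cE; apply: spanB; last exact: bE.
  apply: spanB; last exact: aE.
  by apply: spanD; [apply/spanZ/EG3|apply/EG3/wE].
have antiG v : in_span G v -> in_span G (a (b v) + b (a v)).
  move=> Gv; rewrite three_square_zero_anticomm lam2 scale0r subr0; apply: spanD; first exact: spanZ.
  apply/G3G/spanB; last by apply/cG3/wE.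
  by apply: spanD; [apply/spanZ/EG3/wE|apply/EG3/wE].
have ge i v : [\/ v = a (e i), v = b (e i), v = a (b (e i)) | v = b (a (e i))] -> in_span G v.
  by move=> h; apply: span_gen; right; exists i.
have aG v : in_span G v -> in_span G (a v).
  apply: span_lin => _ [[i ->]|[i [->|->|->|->]]].
  - by apply: (ge i); constructor 1.
  - by rewrite aa; apply: span0.
  - by apply: (ge i); constructor 3.
  - by rewrite aa; apply: span0.
  - have -> : a (b (a (e i))) = a (b (a (e i))) + b (a (a (e i))) by rewrite aa linear0 addr0.
    by apply/antiG/(ge i); constructor 1.
have bG v : in_span G v -> in_span G (b v).
  apply: span_lin => _ [[i ->]|[i [->|->|->|->]]].
  - by apply: (ge i); constructor 2.
  - by apply: (ge i); constructor 4.
  - by rewrite bb; apply: span0.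
  - have -> : b (a (b (e i))) = a (b (b (e i))) + b (a (b (e i))) by rewrite bb linear0 add0r.
    by apply/antiG/(ge i); constructor 2.
  - by rewrite bb; apply: span0.
have EG v : in_span E v -> in_span G v by move=> /EG3 /G3G.
have cG v : in_span G v -> in_span G (c v).
  move=> Gv; rewrite cE; apply: spanB; last exact: bG.
  apply: spanB; last exact: aG.
  by apply: spanD; [apply: spanZ|apply/EG/wE].
have einj : injective e.
  move=> i j eij; apply: contrapT => /eqP ij.
  have delta m : \sum_k (k == m)%:R *: e k = e m.
    rewrite (bigD1 m) //= eqxx scale1r big1 ?addr0 // => k /negbTE->.
    by rewrite scale0r.
  have /efree/(_ i) : \sum_k ((k == i)%:R - (k == j)%:R) *: e k = 0.
    under eq_bigr do rewrite scalerBl.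
    by rewrite sumrB !delta eij subrr.
  by rewrite eqxx (negbTE ij) subr0 => /eqP; rewrite oner_eq0.
have iE : lin_indep E.
  move=> s d us sE s0 v vs; have [i vi] := sE v vs.
  have := efree (fun k => if e k \in s then d (e k) else 0) _ i; rewrite -vi vs; apply.
  have -> : \sum_(i < n) (if e i \in s then d (e i) else 0) *: e i =
     \sum_(v <- map e (enum 'I_n)) (if v \in s then d v else 0) *: v.
    by rewrite big_map big_enum.
  rewrite -(@sum_uniq_sub _ _ _ s _ d id) //.
    by rewrite map_inj_uniq ?enum_uniq.
  by move=> x /sE[j ->]; apply: map_f; rewrite mem_enum.
(* The basis extends [e]: the matrix [A] is then a diagonal block of [w], and the added vectors
   contribute no trace because [w] lands in the span of [e]. *)
have [T [TG TE iET sG]] := @basis_ext _ _ E G iE.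
have [t0 Tt0] : exists s : seq V, forall x, T x -> x \in s.
  exists (flatten [seq [:: e i; a (e i); b (e i); a (b (e i)); b (a (e i))] | i <- enum 'I_n]).
  move=> v /TG[[i ->]|[i h]]; apply/flatten_mapP; exists i; rewrite ?mem_enum // !inE ?eqxx //.
  by case: h => ->; rewrite eqxx ?orbT.
pose s := undup [seq v <- t0 | `[< T v >]].
have sT v : (v \in s) <-> T v.
  rewrite mem_undup mem_filter; split=> [/andP[/asboolP//]|Tv].
  by rewrite Tt0 // andbT; apply/asboolP.
have us : uniq s by apply: undup_uniq.
pose g (i : 'I_(n + size s)) := match fintype.split i with inl j => e j | inr j => s`_j end.
have gl j : g (lshift _ j) = e j by rewrite /g (unsplitK (inl j)).
have gr j : g (rshift _ j) = s`_j by rewrite /g (unsplitK (inr j)).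
have gET v : (E v \/ T v) <-> exists i, v = g i.
  split=> [[[i ->]|/sT /(nthP 0)[j js <-]]|[i ->]].
  - by exists (lshift _ i); rewrite gl.
  - by exists (rshift _ (Ordinal js)); rewrite gr.
  - by rewrite /g; case: fintype.split => j; [left; exists j|right; apply/sT/mem_nth].
have ginj : injective g.
  move=> i j; rewrite /g -{2}[i]fintype.splitK -{2}[j]fintype.splitK; case: (fintype.split i) (fintype.split j) => i' [] j'.
  - by move=> /einj ->.
  - by move=> eq; case: (TE (e i')); [rewrite eq; apply/sT/mem_nth|exists i'].
  - by move=> eq; case: (TE (e j')); [rewrite -eq; apply/sT/mem_nth|exists j'].
  - by move=> /eqP; rewrite nth_uniq // => /eqP ij; rewrite (val_inj ij).
have [L LE] : exists L : 'I_(n + size s) -> {linear V -> F^o},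
    forall i j, L j (g i) = (i == j)%:R.
  have /choice[L LP] : forall j, exists L : {linear V -> F^o}, forall i, L (g i) = (i == j)%:R.
    move=> j; have [||L LP] := @lin_ext_fam _ _ F^o 'I_(n + size s) (fun _ => True) g
      (fun i => (i == j)%:R).
    - by move=> i k _ _; apply: ginj.
    - by apply: lin_indep_sub iET => v [i [_ ->]]; apply/gET; exists i.
    - by exists L => i; apply: LP.
  by exists L => i j; apply: LP.
have Gg v : in_span G v -> in_span (fun v => exists i, v = g i) v.
  by apply: span_sub => x Gx; apply: span_mono (sG x Gx) => y /gET.
have gG i : in_span G (g i).
  have : E (g i) \/ T (g i) by apply/gET; exists i.
  by move=> [Eg|/TG Gg']; [apply/EG/span_gen|apply: span_gen].
have tr0 (f : {linear V -> V}) : square_zero f -> (forall v, in_span G v -> in_span G (f v)) ->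
    \sum_i L i (f (g i)) = 0.
  by move=> ff fG; apply: square_zero_trace => // i; apply/Gg/fG.
have trw : \sum_i L i (w (g i)) = \sum_i A i i.
  rewrite big_split_ord /= [X in _ + X]big1 ?addr0 => [|j _].
    apply: eq_bigr => i _; rewrite gl eA linear_sum (bigD1 i) //= linearZ /= -gl LE eqxx.
    rewrite [_ *: 1]mulr1 big1 ?addr0 // => j ji; rewrite linearZ /= -gl LE.
    by rewrite (inj_eq (@lshift_inj _ _)) (negbTE ji) [_ *: _]mulr0.
  apply: (@span_eq _ _ _ (L (rshift n j)) \0 _ _ _ (wE (g (rshift n j)))) => _ [i ->] /=.
  by rewrite -gl LE eq_lrshift.
have : \sum_i L i (lam *: g i + w (g i)) = 0.
  under eq_bigr => i _ do rewrite abc !linearD.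
  by rewrite !big_split /= !tr0 // !addr0.
under eq_bigr => i _ do rewrite linearD linearZ /= LE eqxx [_ *: 1]mulr1.
rewrite big_split /= trw sumr_const card_ord => /eqP; rewrite addr_eq0 => /eqP h.
have lamN : - lam = lam by apply/eqP; rewrite eq_sym -addr_eq0 lam2.
have [h0|h0] := natmul_double0 (n + size s) lam2; rewrite h0 in h; [left|right].
  by apply/eqP; rewrite -oppr_eq0 -h.
by rewrite -lamN h opprK.
Qed.
End Necessity.

(** * The ideal of maps of small rank *)

Section SmallIdeal.
Variables (F : fieldType) (V : lmodType F) (B : V -> Prop).

(* The two-sided ideal of the maps whose rank is at most a finite multiple of
   the cardinality of [B]. *)
Definition small (f : V -> V) : Prop := exists n (h : nat -> V -> V), forall x,
  in_span (fun y => exists i v, [/\ (i < n)%N, B v & y = h i v]) (f x).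

Lemma smallP (al : F) (f g k : V -> V) : small f -> small g ->
  (forall x, k x = al *: f x + g x) -> small k.
Proof.
move=> [n [h hf]] [m [h' hg]] kE.
exists (n + m)%N, (fun i => if (i < n)%N then h i else h' (i - n)%N) => x; rewrite kE.
apply: spanP.
  apply: span_mono (hf x) => _ [i [v [im Bv ->]]]; exists i, v.
  by rewrite im ltn_addr.
apply: span_mono (hg x) => _ [i [v [im Bv ->]]]; exists (n + i)%N, v.
by rewrite ltn_add2l [(n + i < n)%N]ltnNge leq_addr /= addKn.
Qed.

Lemma small_scale (al : F) (f k : V -> V) : small f -> (forall x, k x = al *: f x) -> small k.
Proof.
move=> [n [h hf]] kE; exists n, h => x; rewrite kE; exact: spanZ.
Qed.

Lemma small_sum (f g k : V -> V) : small f -> small g -> (forall x, k x = f x + g x) -> small k.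
Proof. by move=> sf sg kE; apply: (smallP (al := 1) sf sg) => x; rewrite scale1r. Qed.

Lemma small_compl (L : {linear V -> V}) (f : V -> V) : small f -> small (fun x => L (f x)).
Proof.
move=> [n [h hf]]; exists n, (fun i v => L (h i v)) => x.
by apply: span_lin (hf x) => _ [i [v [im Bv ->]]]; apply: span_gen; exists i, v.
Qed.

Lemma small_compr (f g : V -> V) : small f -> small (fun x => f (g x)).
Proof. by move=> [n [h hf]]; exists n, h => x. Qed.

(** Put [p = a b] and compute modulo the ideal. Since [a] and [b] commute, [p^2 = 0] and
    [2 lam c = lam^2 - 2 p]. Squaring gives [lam^2 = 4 p], multiplying this by [p] gives [p = 0],
    and finally [lam^2 = 0]. *)
Lemma small_id_sum_three_square_zero (a b c w : {linear V -> V}) (lam : F) :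
  square_zero a -> square_zero b -> square_zero c ->
  (forall x, lam *: x + w x = a x + b x + c x) -> lam + lam != 0 -> small w -> small id.
Proof.
move=> aa bb cc abc lam2 sw.
have lam0 : lam != 0 by apply: contraNneq lam2 => ->; rewrite addr0.
pose E1 x := lam *: w x + w (a x + b x) - c (w x).
have s1 : small E1.
  apply: (smallP (al := lam) sw (g := fun x => w (a x + b x) - c (w x))).
    apply: (smallP (al := -1) (small_compl c sw) (small_compr (fun x => a x + b x) sw)) => x.
    by lmod V.
  by move=> x; rewrite /E1; lmod V.
have E1E x : a (b x) + b (a x) = lam ^+ 2 *: x - (lam + lam) *: c x + E1 x.
  exact: three_square_zero_anticomm.
(* As [a^2 = 0], the map [a] commutes with [a b + b a]; inserting the formula [E1E] leaves
   [lam + lam] times the commutator of [a] and [c]. *)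
have s2 : small (fun x => a (c x) - c (a x)).
  apply: (small_scale (al := (lam + lam)^-1) (f := fun x => a (E1 x) - E1 (a x))).
    apply: (smallP (al := -1) (small_compr a s1) (small_compl a s1)) => x; by lmod V.
  move=> x; have h1 := congr1 a (E1E x); have h2 := E1E (a x).
  rewrite aa linear0 addr0 in h2; rewrite linearD aa add0r h2 in h1.
  move: h1; rewrite (linearD a) (linearB a) !(linearZZ a) => h1.
  have -> : a (E1 x) - E1 (a x) = (lam + lam) *: (a (c x) - c (a x)).
    have -> : a (E1 x) = lam ^+ 2 *: a x - (lam + lam) *: a (c x) + a (E1 x) -
      lam ^+ 2 *: a x + (lam + lam) *: a (c x) by lmod V.
    by rewrite -h1; lmod V.
  by rewrite scalerK.
have cE x : c x = lam *: x + w x - a x - b x by rewrite abc; lmod V.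
have s3 : small (fun x => a (b x) - b (a x)).
  apply: (smallP (al := -1) s2 (g := fun x => a (w x) - w (a x))).
    by apply: (smallP (al := -1) (small_compr a sw) (small_compl a sw)) => x; lmod V.
  by move=> x; rewrite !cE !(linearB a) (linearD a) (linearZZ a) aa; lmod V.
pose E x := E1 x + (a (b x) - b (a x)).
have sE : small E by apply: small_sum s1 s3 _.
have c2 x : (lam + lam) *: c x = lam ^+ 2 *: x - 2%:R *: a (b x) + E x.
  have -> : E x = a (b x) + b (a x) - lam ^+ 2 *: x + (lam + lam) *: c x + (a (b x) - b (a x)).
    by rewrite E1E /E; lmod V.
  by lmod V.
have s4 : small (fun x => a (b (a (b x)))).
  apply: (small_scale (al := -1) (small_compl a (small_compr b s3))) => x.
  by rewrite linearB aa; lmod V.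
have s5 : small (fun x => lam ^+ 2 *: x - 4%:R *: a (b x)).
  pose G x := lam ^+ 2 *: E x + (lam + lam) *: c (E x) - 2%:R *: E (a (b x)).
  have sG : small G.
    apply: (smallP (al := lam ^+ 2) sE (g := fun x => (lam + lam) *: c (E x) - 2%:R *: E (a (b x)))).
      apply: (smallP (al := lam + lam) (small_compl c sE)
        (g := fun x => - 2%:R *: E (a (b x)))) => [|x]; last by lmod V.
      exact: (small_scale (al := - 2%:R) (small_compr (fun x => a (b x)) sE)).
    by move=> x; rewrite /G; lmod V.
  apply: (small_scale (al := - (lam ^+ 2)^-1)
    (f := fun x => 4%:R *: a (b (a (b x))) + G x)) => [|x].
    by apply: (smallP (al := 4%:R) s4 sG).
  have h : lam ^+ 2 *: (lam ^+ 2 *: x - 4%:R *: a (b x)) + 4%:R *: a (b (a (b x))) + G x = 0.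
    have cc0 : (lam + lam) *: c (lam ^+ 2 *: x - 2%:R *: a (b x) + E x) = 0.
      by rewrite -c2 linearZ /= cc !scaler0.
    rewrite -cc0 (linearD c) (linearB c) !(linearZZ c).
    rewrite /G.
    have := c2 x; have := c2 (a (b x)) => h1 h2.
    transitivity (lam ^+ 2 *: ((lam + lam) *: c x) - 2%:R *: ((lam + lam) *: c (a (b x)))
       + (lam + lam) *: c (E x)); last by lmod V.
    by rewrite h1 h2; lmod V.
  have l2 : lam ^+ 2 != 0 by rewrite expf_neq0.
  have -> : 4%:R *: a (b (a (b x))) + G x = - (lam ^+ 2 *: (lam ^+ 2 *: x - 4%:R *: a (b x))).
    by apply/eqP; rewrite -addr_eq0 addrC addrA h.
  by rewrite scaleNr scalerN opprK scalerK.
have s6 : small (fun x => a (b x)).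
  apply: (small_scale (al := (lam ^+ 2)^-1) (f := fun x => lam ^+ 2 *: a (b x))) => [|x].
    apply: (smallP (al := 4%:R) s4 (small_compr (fun x => a (b x)) s5)) => x; by lmod V.
  by rewrite scalerK // expf_neq0.
apply: (small_scale (al := (lam ^+ 2)^-1) (f := fun x => lam ^+ 2 *: x)) => [|x].
  by apply: (smallP (al := 4%:R) s6 s5) => x; lmod V.
by rewrite scalerK // expf_neq0.
Qed.
End SmallIdeal.

(** * Dominant eigenvalues and doubly independent sets *)

Section Dominant.
Variables (F : fieldType) (V : lmodType F).

Lemma image_basis (w : {linear V -> V}) :
  exists B : V -> Prop, is_basis_of (fun y => exists x, y = w x) B.
Proof.
have [T [TR _ iT RT]] := @basis_ext _ _ _ (fun y => exists x, y = w x) (@lin_indep0 F V).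
exists T; split=> [//||x Rx]; first by apply: lin_indep_sub iT; right.
by apply: span_mono (RT x Rx) => v [].
Qed.

Lemma basis_infset (B : V -> Prop) : infinite_dim V -> (forall x, in_span B x) -> infset B.
Proof.
move=> infV BV; have [[s Bs]|//] := finite_or_infset B; exfalso.
by apply: (@infinite_dim_nspan _ _ s infV) => x; apply: span_mono (BV x).
Qed.

(** Any basis of the image injects into [X] by [lin_indep_le_set]; an injection of a basis of [V]
    into it would contradict the last hypothesis. *)
Lemma rank_lt_dim_of_span (X : V -> Prop) (h : nat -> V -> V) (w : V -> V) : infset X ->
  (forall x, in_span (fun y => exists i v, X v /\ y = h i v) (w x)) ->
  (forall B, @is_basis_of F V (fun=> True) B -> ~ le_set B X) -> rank_lt_dim w.
Proof.
move=> infX wX nX [B1 [B2 [b1 [B2w iB2 _] le12]]].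
apply: (nX B1 b1); apply: (@le_set_trans _ _ _ B1 B2 X) => //.
by apply: lin_indep_le_set iB2 infX _ => x /B2w[y ->].
Qed.

Lemma rank_lt_dim_finite (w : V -> V) : infinite_dim V -> finite_rank w -> rank_lt_dim w.
Proof.
move=> infV [s ws] [B1 [B2 [[_ _ B1V] [B2w iB2 _] le12]]].
have [|t B2t] := @lin_indep_finite _ _ B2 s iB2; first by move=> x /B2w[y ->].
apply: (finite_not_infset B2t); apply: le_set_trans le12.
by apply: basis_infset => // x; apply: B1V.
Qed.

(** With [B] a basis of the image of [u - lam], the identity is small, so [V] is spanned by finitely
    many families indexed by [B]. This is absurd for [B] finite, and for [B] infinite it bounds the
    dimension of [V] by the rank. *)
Lemma dominant_sum_three_square_zero (u a b c : {linear V -> V}) (lam : F) :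
  infinite_dim V -> square_zero a -> square_zero b -> square_zero c ->
  (forall x, u x = a x + b x + c x) -> lam + lam != 0 -> ~ dominant_eigenvalue u lam.
Proof.
move=> infV aa bb cc uE lam2.
have [w wE] : exists w : {linear V -> V}, forall x, w x = u x - lam *: x.
  by exists (u \- (lam \*: idfun)).
have [B [Bw iB wB]] := image_basis w.
have sw : small B w.
  exists 1%N, (fun _ v => v) => x; apply: span_mono (wB (w x) _) => [v Bv|]; last by exists x.
  by exists 0%N, v.
have [|n [h hV]] := small_id_sum_three_square_zero aa bb cc _ lam2 sw.
  by move=> x; rewrite -uE wE; lmod V.
apply; have [[s Bs]|infB] := finite_or_infset B.
  exfalso; apply: (@infinite_dim_nspan _ _
    (flatten [seq [seq h i v | v <- s] | i <- iota 0 n]) infV) => x.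
  apply: span_mono (hV x) => _ [i [v [im Bv ->]]].
  apply/flatten_mapP; exists i; first by rewrite mem_iota.
  by apply: map_f; apply: Bs.
have [T [_ _ iT VT]] := @basis_ext _ _ _ (fun=> True) (@lin_indep0 F V).
exists (fun v => False \/ T v), B; split.
- by split=> // x _; apply: VT.
- have -> : (fun y => exists x, y = u x - lam *: x) = (fun y => exists x, y = w x).
    by apply/funext => y; apply/propext; split=> -[x ->]; exists x; rewrite wE.
  by split.
- apply: (@lin_indep_le_set _ _ _ B h iT infB) => x _.
  by apply: span_mono (hV x) => _ [i [v [_ Bv ->]]]; exists i, v.
Qed.
End Dominant.

Section Doubling.
Variables (F : fieldType) (V : lmodType F) (u : {linear V -> V}).

Definition doubled (X : V -> Prop) v := X v \/ exists x, X x /\ v = u x.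

(** [lin_indep] speaks of a set, so the first two clauses are what excludes coincidences among the
    vectors [x] and [u x]. *)
Definition doubly_indep (X : V -> Prop) :=
  [/\ forall x y, X x -> X y -> u x = u y -> x = y,
      forall x y, X x -> X y -> x <> u y & lin_indep (doubled X)].

Lemma doubly_indep_sub (X Y : V -> Prop) :
  (forall x, X x -> Y x) -> doubly_indep Y -> doubly_indep X.
Proof.
move=> XY [h1 h2 h3]; split=> [x y /XY Yx /XY Yy|x y /XY Yx /XY Yy|]; auto.
by apply: lin_indep_sub h3 => v [/XY|[x [/XY Yx ->]]]; [left|right; exists x].
Qed.

Lemma maximal_doubly_indep : exists X, doubly_indep X /\
  forall Y : V -> Prop, (forall x, X x -> Y x) -> doubly_indep Y -> forall x, Y x -> X x.
Proof.
pose Q (s : seq V) := doubly_indep (fun v => v \in s).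
have [|X [XQ Xmax]] := @zorn_finite_character _ Q.
  by split=> //; apply: lin_indep_sub (@lin_indep0 F V) => v [|[x []]].
exists X; split; last first.
  move=> Y XY dY; apply: Xmax => // s sY; exact: doubly_indep_sub dY.
(* The first two clauses concern two elements at a time; for independence, a relation is tested on
   the finite list of the [x] from which its vectors come. *)
have Q2 x y : X x -> X y -> Q [:: x; y].
  by move=> Xx Xy; apply: XQ => z; rewrite !inE => /orP[] /eqP->.
split=> [x y Xx Xy|x y Xx Xy|s c us sX s0 v vs].
- by case: (Q2 x y Xx Xy) => h _ _; apply: h; rewrite !inE eqxx ?orbT.
- by case: (Q2 x y Xx Xy) => _ h _; apply: h; rewrite !inE eqxx ?orbT.
have /choice[p pP] : forall v, exists x, v \in s -> X x /\ (v = x \/ v = u x).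
  move=> z; have [/sX[Xz|[x [Xx zx]]]|] := boolP (z \in s); last by exists 0.
    by exists z => _; split=> //; left.
  by exists x => _; split=> //; right.
have [|_ _ iQ] := XQ (map p s); first by move=> _ /mapP[z /pP[Xp _] ->].
apply: (iQ s c) => // z zs; have [_ [zp|zp]] := pP z zs; [left|right].
  by rewrite zp map_f.
by exists (p z); rewrite map_f.
Qed.

Variable X : V -> Prop.
Hypothesis dX : doubly_indep X.
Hypothesis Xmax : forall Y : V -> Prop, (forall x, X x -> Y x) -> doubly_indep Y ->
  forall x, Y x -> X x.

(** Otherwise [y] and [u y] would be independent modulo the doubled set, and [y] could be adjoined
    to [X]. *)
Lemma maximal_doubly_indep_eigen y : ~ in_span (doubled X) y ->
  exists al, in_span (doubled X) (u y - al *: y).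
Proof.
move=> ny; apply: span_or; apply: contrapT => nuy; case: dX => Xinj Xu iX.
have Xy x : X x -> x <> y by move=> Xx xy; apply/ny/span_gen; left; rewrite -xy.
have uXy x : X x -> u x <> y by move=> Xx xy; apply/ny/span_gen; right; exists x.
have Xuy x : X x -> x <> u y.
  by move=> Xx xy; apply/nuy/span_gen; left; left; rewrite -xy.
have uXuy x : X x -> u x <> u y.
  by move=> Xx xy; apply/nuy/span_gen; left; right; exists x.
suff Xy' : X y by case: (Xy y Xy').
apply: (Xmax (Y := fun v => X v \/ v = y)); [by left| |by right].
split=> [x z [Xx|->] [Xz|->] //|x z [Xx|->] [Xz|->]|].
- exact: Xinj.
- by move=> /uXuy; case.
- by move=> /esym /uXuy; case.
- exact: Xu.
- exact: Xuy.
- by move=> /esym; apply: uXy.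
- by move=> yuy; apply/nuy/span_gen; right.
- apply: lin_indep_sub (lin_indep_add (lin_indep_add iX ny) nuy) => v.
  move=> [[Xv|->]|[x [[Xx|->] ->]]]; [by left; left; left|by left; right| |by right].
  by left; left; right; exists x.
Qed.

(** Modulo the span of [doubled X], every vector outside it is an eigenvector, so there is a common
    eigenvalue. The bound 3 comes from applying [u] to the vectors [u x] of the doubled set. *)
Lemma maximal_doubly_indep_range : exists lam, forall x,
  in_span (fun y => exists i v, [/\ (i < 3)%N, X v & y = iter i u v]) (u x - lam *: x).
Proof.
case: dX => _ _ iX.
have [T [_ TX iXT XT]] := @basis_ext _ _ _ (fun=> True) iX.
have indT t t' p q : T t -> T t' -> t <> t' -> in_span (doubled X) (p *: t + q *: t') -> p = 0.
  move=> Tt Tt' tt' h; apply: contrapT => /eqP p0.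
  have : lin_indep (fun v => (doubled X v \/ v = t') \/ v = t).
    by apply: lin_indep_sub iXT => v [[Xv|->]|->]; [left|right|right].
  move=> /lin_indep_notin; apply; first by move=> [Xt|//]; apply: (TX t).
  have -> : t = p^-1 *: ((p *: t + q *: t') - q *: t') by rewrite addrK scalerK.
  apply/spanZ/spanB; first by apply: span_mono h; left.
  by apply/spanZ/span_gen; right.
have nT t : T t -> ~ in_span (doubled X) t.
  move=> Tt; apply: lin_indep_notin; last exact: TX.
  by apply: lin_indep_sub iXT => v [Xv|->]; [left|right].
have [lam Tlam] : exists lam, forall t, T t -> in_span (doubled X) (u t - lam *: t).
  have [[t0 Tt0]|nT0] := pselect (exists t, T t); last first.
    by exists 0 => t Tt; case: nT0; exists t.
  have [lam h0] := maximal_doubly_indep_eigen (nT t0 Tt0); exists lam => t Tt.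
  have [->//|tt0] := pselect (t = t0).
  have [al h1] := maximal_doubly_indep_eigen (nT t Tt).
  (* The eigenvalue of [t + t0] must agree with that of [t] and with that of [t0]. *)
  have [|be h2] := @maximal_doubly_indep_eigen (t + t0).
    move=> h; have : 1 = 0 :> F by apply: (indT t t0 1 1); rewrite ?scale1r.
    by move/eqP; rewrite oner_eq0.
  have h3 : in_span (doubled X) ((be - al) *: t + (be - lam) *: t0).
    have -> : (be - al) *: t + (be - lam) *: t0 = (u t - al *: t) + (u t0 - lam *: t0) -
      (u (t + t0) - be *: (t + t0)) by rewrite (linearD u); lmod V.
    by apply: spanB => //; apply: spanD.
  have e1 := indT _ _ _ _ Tt Tt0 tt0 h3.
  rewrite addrC in h3; have e2 := indT _ _ _ _ Tt0 Tt (nesym tt0) h3.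
  move/eqP: e1; rewrite subr_eq0 => /eqP e1; move/eqP: e2; rewrite subr_eq0 => /eqP e2.
  by rewrite -e2 e1.
exists lam => x; pose w : {linear V -> V} := (u \- (lam \*: idfun)).
set G := fun y => _.
have gG i v : (i < 3)%N -> X v -> in_span G (iter i u v).
  by move=> i3 Xv; apply: span_gen; exists i, v.
have dG v : in_span (doubled X) v -> in_span G v.
  by apply: span_sub => y [Xy|[z [Xz ->]]]; [apply: (gG 0%N)|apply: (gG 1%N)].
apply: (@span_lin _ _ w _ G _ x (XT x I)) => v [[Xv|[y [Xy ->]]]|Tv] /=.
- by apply: spanB; [apply: (gG 1%N)|apply/spanZ/(gG 0%N)].
- by apply: spanB; [apply: (gG 2%N)|apply/spanZ/(gG 1%N)].
- exact/dG/Tlam.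
Qed.
End Doubling.

(** * Sufficiency when the doubly independent set is infinite *)

Section Sufficiency.
Variables (F : fieldType) (V : lmodType F) (u : {linear V -> V}).

Let sum3 := exists a b c : {linear V -> V},
  [/\ square_zero a, square_zero b, square_zero c & forall x, u x = a x + b x + c x].

(** A complement [T] of the doubled set is no larger than [X], so its vectors fit in as chains of
    length one and the chains fill [V]. *)
Lemma three_square_zero_small_basis (X B : V -> Prop) : infinite_dim V ->
  doubly_indep u X -> infset X -> is_basis_of (fun=> True) B -> le_set B X -> sum3.
Proof.
move=> infV [Xinj Xu iX] infX [_ iB BV] BX.
have [T [_ TX iXT XT]] := @basis_ext _ _ _ (fun=> True) iX.
have infB : infset B by apply: basis_infset => // x; apply: BV.
have TleX : le_set T X.
  apply: le_set_trans BX; apply: (@lin_indep_le_set _ _ T B (fun _ v => v)) => //.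
    by apply: lin_indep_sub iXT; right.
  by move=> x _; apply: span_mono (BV x I) => v Bv; exists 0%N, v.
(* The second summand is zero; gluing only turns a decomposition on the whole span into global
   maps. *)
apply: (@three_square_zero_glue _ _ (fun v => doubled u X v \/ T v) (fun=> False)).
- by apply: lin_indep_sub iXT => v [|[]].
- by move=> v _ [].
- by move=> x; apply: span_mono (XT x I); left.
- apply: three_square_zero_infinite => //; last by move=> v _; apply: XT.
  by move=> x Xx; split=> h; apply: (TX _ h); [left|right; exists x].
- apply: (three_square_zero_scalar (lam := 0)) => //; first exact: lin_indep0.
  + by rewrite addr0.
  + by left.
Qed.

(** [Z] enlarges the doubled set until its span contains a basis of the image of [w] and preimages
    of that basis. The span is then [u]-stable and has a complement in the kernel of [w], which is
    infinite because otherwise [V] would have a basis no larger than [X]. *)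
Lemma three_square_zero_infinite_rank (X : V -> Prop) (lam : F) : infinite_dim V ->
  doubly_indep u X -> infset X ->
  (forall x, in_span (fun y => exists i v, X v /\ y = iter i u v) (u x - lam *: x)) ->
  (forall B, @is_basis_of F V (fun=> True) B -> ~ le_set B X) -> lam + lam = 0 -> sum3.
Proof.
move=> infV [Xinj Xu iX] infX wX nX lam2.
have [w wE] : exists w : {linear V -> V}, forall x, w x = u x - lam *: x.
  by exists (u \- (lam \*: idfun)).
have uw x : u x = lam *: x + w x by rewrite wE; lmod V.
have [B [Bw iB wB]] := image_basis w.
have wB' x : in_span B (w x) by apply: wB; exists x.
have BX : le_set B X.
  by apply: (@lin_indep_le_set _ _ B X (fun i v => iter i u v)) => // x /Bw[y ->]; rewrite wE.
have /choice[sg sgP] : forall y, exists x, B y -> w x = y.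
  move=> y; have [/Bw[x ->]|] := pselect (B y); first by exists x.
  by exists 0.
have [Z [ZC ZX iXZ CZ]] := @basis_ext _ _ _ (fun v => B v \/ exists y, B y /\ v = sg y) iX.
have ZleX : le_set Z X.
  apply: (le_set_trans (le_set_sub ZC)); apply: le_set_or => //.
  by apply: le_set_trans BX; apply: (le_set_image (h := sg) 0) => _ [y [By ->]]; exists y.
set D := fun v => _ in iXZ CZ.
have BD x : in_span B x -> in_span D x by apply: span_sub => v Bv; apply: CZ; left.
have [T [Tker TD iDT DT]] := @basis_ext _ _ D (fun x => w x = 0) iXZ.
have DTV x : in_span (fun v => D v \/ T v) x.
  have [q Dq wq] : exists2 q, in_span D q & w q = w x.
    move: (wB' x); move: (w x); apply: span_ind => [|c _ _ [q Dq <-] [q' Dq' <-]|y By].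
    - by exists 0; rewrite ?linear0 //; apply: span0.
    - by exists (c *: q + q'); [apply: spanP|rewrite linearP].
    - by exists (sg y); [apply: CZ; right; exists y|apply: sgP].
  rewrite -[x](subrK q); apply: spanD; last by apply: span_mono Dq; left.
  by apply: DT; rewrite linearB wq subrr.
have infT : infset T.
  have [[t Tt]|//] := finite_or_infset T; exfalso.
  apply: (nX (fun v => D v \/ T v)); first by split.
  apply: le_set_or => //.
    apply: le_set_or => //; apply: le_set_or => //; first exact: le_set_sub.
    by apply: (le_set_image (h := u) 0) => _ [x [Xx ->]]; exists x.
  apply: le_set_trans infX; exists (fun v => index v t); split=> // x y /Tt xt /Tt yt e.
  by rewrite -(nth_index 0 xt) e nth_index.
apply: (three_square_zero_glue iDT).
- by move=> v Dv Tv; apply: (TD v).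
- exact: DTV.
- apply: three_square_zero_infinite => //.
    by move=> x Xx; split=> h; apply: (ZX _ h); [left|right; exists x].
  by move=> v Dv; rewrite uw; apply: spanD; [apply/spanZ/span_gen|apply: BD].
- apply: (three_square_zero_scalar (lam := lam)) => //; last by right.
  + by apply: lin_indep_sub iDT; right.
  + by move=> v /Tker wv; rewrite uw wv addr0.
Qed.
End Sufficiency.

Theorem theorem5 (F : fieldType) (V : lmodType F) (u : {linear V -> V}) :
  infinite_dim V ->
  ((exists a b c : {linear V -> V},
      [/\ square_zero a, square_zero b, square_zero c &
          forall x, u x = a x + b x + c x])
   <->
   (~ (exists (lam : F) (w : {linear V -> V}),
         [/\ finite_rank w,
             (exists t : F, [/\ is_trace w t, t != 0 & t != lam])
           & forall x, u x = lam *: x + w x])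
    /\
    ~ (~~ (2%N \in [pchar F]) /\
       exists lam : F, lam != 0 /\ dominant_eigenvalue u lam))).
Proof.
(* The equation [lam + lam = 0] covers at once the two ways in which [lam] escapes (ii) although
   dominant. *)
move=> infV; have dbl0 (lam : F) : (lam + lam == 0) = (lam == 0) || (2%N \in [pchar F]).
  by rewrite -mulr2n -mulr_natr mulf_eq0 [2%N \in _]inE.
split=> [[a [b [c [aa bb cc uE]]]]|[nI nII]].
  split=> [[lam [w [fw [t [trt t0 tl]] uw]]]|[p2 [lam [lam0]]]]; last first.
    by apply: (dominant_sum_three_square_zero infV aa bb cc uE); rewrite dbl0 negb_or lam0.
  have abc x : lam *: x + w x = a x + b x + c x by rewrite -uw uE.
  have [lam2|lam2] := eqVneq (lam + lam) 0.
    have [e|e] := trace_sum_three_square_zero aa bb cc abc lam2 trt.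
      by rewrite e eqxx in t0.
    by rewrite e eqxx in tl.
  (* When [lam + lam] is non-zero, (i) falls under the case of dominant eigenvalues, since [u - lam]
     has finite rank. *)
  apply: (dominant_sum_three_square_zero infV aa bb cc uE lam2).
  apply: rank_lt_dim_finite => //; case: fw => s ws; exists s => x.
  by rewrite uw addrAC subrr add0r.
have [X [dX Xmax]] := maximal_doubly_indep u.
have [lam wX] := maximal_doubly_indep_range dX Xmax.
have lam2 : dominant_eigenvalue u lam -> lam + lam = 0.
  move=> dom; apply/eqP; rewrite dbl0; apply: contrapT => /negP; rewrite negb_or => /andP[l0 p2].
  by apply: nII; split=> //; exists lam.
have [[s Xs]|infX] := finite_or_infset X.
  have [w wE] : exists w : {linear V -> V}, forall x, w x = u x - lam *: x.
    by exists (u \- (lam \*: idfun)).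
  have uw x : u x = lam *: x + w x by rewrite wE; lmod V.
  have fw : finite_rank (fun x => u x - lam *: x).
    exists (flatten [seq [seq iter i u v | v <- s] | i <- iota 0 3]) => x.
    apply: span_mono (wX x) => _ [i [v [i3 Xv ->]]].
    apply/flatten_mapP; exists i; first by rewrite mem_iota.
    by apply: map_f; apply: Xs.
  have fw' : finite_rank w by case: fw => t wt; exists t => x; rewrite wE.
  apply: (three_square_zero_finite_rank uw infV fw').
    by apply: lam2; apply: rank_lt_dim_finite.
  move=> t trt; apply: contrapT => /not_orP[/eqP t0 /eqP tl]; apply: nI.
  by exists lam, w; split=> //; exists t.
have wX' x : in_span (fun y => exists i v, X v /\ y = iter i u v) (u x - lam *: x).
  by apply: span_mono (wX x) => _ [i [v [_ Xv ->]]]; exists i, v.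
(* If no basis of [V] injects into [X], the rank of [u - lam] is below the dimension, so [lam] is
   dominant and [lam2] applies. *)
have [[B [bB BX]]|nB] := pselect (exists B, @is_basis_of F V (fun=> True) B /\ le_set B X).
  exact: three_square_zero_small_basis bB BX.
have nB' B : @is_basis_of F V (fun=> True) B -> ~ le_set B X.
  by move=> bB BX; apply: nB; exists B.
apply: (three_square_zero_infinite_rank infV dX infX wX' nB'); apply: lam2.
exact: (rank_lt_dim_of_span infX wX' nB').
Qed.
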